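(* Let $p$ be a prime. Suppose that $1<q<\infty$, $\frac1q+\frac1{q'}=1$, $-1<\alpha<q-1$ and $b\in CMO^{\max\{q',q\}}(\mathbb{Q}_p)$. Then $T^p_b$ is bounded from $L^q(|x|_p^{\alpha}dx)$ to $L^q(|x|_p^{\alpha}dx)$.
   Context: $\mathbb{Q}_p$ is the field of $p$-adic numbers with norm $|\cdot|_p$ normalized by $|p|_p=p^{-1}$, and $\mathbb{Q}_p^*=\mathbb{Q}_p\setminus\{0\}$. $dx$ is the Haar measure on $\mathbb{Q}_p$ normalized so that $\{x:|x|_p\le 1\}$ has measure $1$; $|E|_H$ is the Haar measure of $E$, and $B_\gamma=\{x\in\mathbb{Q}_p:|x|_p\le p^\gamma\}$ for $\gamma\in\mathbb{Z}$. The $p$-adic Hardy-Littlewood-Pólya operator is $$T^pf(x)=\int_{\mathbb{Q}_p^*}\frac{f(y)}{\max(|x|_p,|y|_p)}\,dy,\qquad x\in\mathbb{Q}_p,$$ and for a locally integrable $b$ on $\mathbb{Q}_p$ its commutator is $T^p_bf=b\,T^pf-T^p(bf)$. For $1\le s<\infty$, $CMO^s(\mathbb{Q}_p)$ is the set of $f\in L^s_{loc}(\mathbb{Q}_p)$ with $$\|f\|_{CMO^s(\mathbb{Q}_p)}=\sup_{\gamma\in\mathbb{Z}}\left(\frac{1}{|B_\gamma|_H}\int_{B_\gamma}|f(x)-f_{B_\gamma}|^s\,dx\right)^{1/s}<\infty,\qquad f_{B_\gamma}=\frac{1}{|B_\gamma|_H}\int_{B_\gamma}f(x)\,dx.$$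 $L^q(|x|_p^\alpha dx)$ is the weighted Lebesgue space on $\mathbb{Q}_p$ with norm $\left(\int_{\mathbb{Q}_p}|f(x)|^q|x|_p^\alpha dx\right)^{1/q}$. An operator $A$ is bounded from $X$ to $Y$ if there is a constant $C$ (independent of $f$) with $\|Af\|_Y\le C\|f\|_X$ for all $f\in X$. *)

(* Defs.v *)
From HB Require Import structures.
From mathcomp Require Import all_boot all_order all_algebra.
From mathcomp Require Import ring lra zify.
From mathcomp Require Import all_classical all_reals all_analysis.
From mathcomp Require Import complex.

Set Implicit Arguments.
Unset Strict Implicit.
Unset Printing Implicit Defensive.

Import Order.TTheory GRing.Theory Num.Theory.
Local Open Scope classical_set_scope.
Local Open Scope ring_scope.

Section PadicAbs.
Variable p : nat.

(* |x|_p = p^(-v_p(x)) on Q, with v_p(x) = v_p(num x) - v_p(den x). *)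
Definition padic_abs (x : rat) : rat :=
  if x == 0 then 0
  else p%:R ^ ((logn p `|denq x|)%:Z - (logn p `|numq x|)%:Z).

Hypothesis p_prime : prime p.

Let p_neq0 : p%:R != 0 :> rat.
Proof. by rewrite pnatr_eq0 -lt0n prime_gt0. Qed.

Let p_gt0 : 0 < p%:R :> rat.
Proof. by rewrite ltr0n prime_gt0. Qed.

Lemma padic_abs0 : padic_abs 0 = 0.
Proof. by rewrite /padic_abs eqxx. Qed.

Lemma padic_abs_gt0 x : x != 0 -> 0 < padic_abs x.
Proof. by move=> /negPf x0; rewrite /padic_abs x0 exprz_gt0. Qed.

Lemma padic_abs_ge0 x : 0 <= padic_abs x.
Proof.
by have [->|/padic_abs_gt0/ltW//] := eqVneq x 0; rewrite padic_abs0.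
Qed.

Lemma padic_abs_frac (a b : int) : a != 0 -> b != 0 ->
  padic_abs (a%:Q / b%:Q) = p%:R ^ ((logn p `|b|)%:Z - (logn p `|a|)%:Z).
Proof.
move=> a0 b0; set x := _ / _.
have x0 : x != 0 by rewrite mulf_neq0 ?invr_neq0 ?intr_eq0.
rewrite /padic_abs (negPf x0); congr (_ ^ _).
have n0 : numq x != 0 by rewrite numq_eq0.
have d0 := denq_neq0 x.
have : a * denq x = numq x * b.
  apply/eqP; rewrite -(eqr_int rat) !intrM.
  by rewrite numqE mulrAC divfK// intr_eq0.
move=> /(congr1 (fun z : int => logn p `|z|%N)) /eqP.
rewrite !abszM !lognM ?absz_gt0// => /eqP.
move: (logn p `|denq x|) (logn p `|numq x|) => u v.
by lia.
Qed.

Lemma padic_absM x y : padic_abs (x * y) = padic_abs x * padic_abs y.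
Proof.
have [->|x0] := eqVneq x 0; first by rewrite mul0r padic_abs0 mul0r.
have [->|y0] := eqVneq y 0; first by rewrite mulr0 padic_abs0 mulr0.
rewrite -[in LHS](divq_num_den x) -[in LHS](divq_num_den y) mulf_div -!intrM.
rewrite padic_abs_frac ?mulf_neq0 ?numq_eq0 ?denq_neq0//.
rewrite /padic_abs (negPf x0) (negPf y0) -expfzDr//.
rewrite !abszM !lognM ?absz_gt0 ?numq_eq0 ?denq_neq0//.
by congr (_ ^ _); lia.
Qed.


Let padic_abs_frac_le1 (a b : int) : b != 0 -> ~~ (p %| `|b|)%N ->
  padic_abs (a%:Q / b%:Q) <= 1.
Proof.
move=> b0 pb; have [->|a0] := eqVneq a 0.
  by rewrite mul0r padic_abs0 ler01.
rewrite padic_abs_frac// lognE p_prime absz_gt0 b0/= (negPf pb) sub0r.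
by rewrite -exprnN -exprVn exprn_ile1 ?invr_ge0 ?(ltW p_gt0)// invf_le1// ler1n prime_gt0.
Qed.

Let padic_abs_le1 x : padic_abs x <= 1 -> ~~ (p %| `|denq x|)%N.
Proof.
have [->|x0] := eqVneq x 0; first by rewrite Euclid_dvd1.
rewrite /padic_abs (negPf x0) => h; apply/negP => pd; move: h.
have n0 : (0 < `|numq x|)%N by rewrite absz_gt0 numq_eq0.
have d0 : (0 < `|denq x|)%N by rewrite absz_gt0 denq_neq0.
have p1 : 1 < p%:R :> rat by rewrite ltr1n prime_gt1.
have pn : ~~ (p %| `|numq x|)%N.
  apply/negP => pn; have : (p %| gcdn `|numq x| `|denq x|)%N.
    by rewrite dvdn_gcd pn.
  by rewrite (eqP (coprime_num_den x)) Euclid_dvd1.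
rewrite [X in _ - X%:Z]lognE p_prime n0/= (negPf pn) subr0 -exprnP.
have : (0 < logn p `|denq x|)%N by rewrite -pfactor_dvdn ?expn1.
by case: (logn _ _) => // k _; rewrite leNgt exprn_egt1.
Qed.

Lemma padic_absN x : padic_abs (- x) = padic_abs x.
Proof. by rewrite /padic_abs oppr_eq0 denqN numqN abszN. Qed.

Lemma padic_abs1 : padic_abs 1 = 1.
Proof.
have n1 : padic_abs 1 != 0 by rewrite gt_eqF// padic_abs_gt0// oner_eq0.
by apply: (mulfI n1); rewrite -padic_absM !mulr1.
Qed.

Lemma padic_abs_ultra x y :
  padic_abs (x + y) <= Num.max (padic_abs x) (padic_abs y).
Proof.
wlog yx : x y / padic_abs y <= padic_abs x.
  move=> h; have /orP[/h//|/h] := le_total (padic_abs y) (padic_abs x).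
  by rewrite addrC maxC.
rewrite max_l//.
have [x0|x0] := eqVneq x 0.
  by rewrite x0 in yx *; rewrite add0r.
have -> : x + y = x * (1 + y / x) by rewrite mulrDr mulr1 mulrCA divff// mulr1.
rewrite padic_absM ler_piMr ?padic_abs_ge0//.
have : padic_abs (y / x) <= 1.
  have xV : padic_abs x * padic_abs x^-1 = 1.
    by rewrite -padic_absM divff// padic_abs1.
  by rewrite padic_absM -xV ler_wpM2r ?padic_abs_ge0.
move: (y / x) => z /padic_abs_le1 zd.
have -> : 1 + z = (denq z + numq z)%:Q / (denq z)%:Q.
  by rewrite intrD mulrDl divff ?intr_eq0 ?denq_neq0// divq_num_den.
by rewrite padic_abs_frac_le1 ?denq_neq0.
Qed.

Lemma padic_absD x y : padic_abs (x + y) <= padic_abs x + padic_abs y.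
Proof.
rewrite (le_trans (padic_abs_ultra x y))// ge_max lerDl lerDr.
by rewrite !padic_abs_ge0.
Qed.

End PadicAbs.

Section CauchySequences.
Variables (p : nat) (p_prime : prime p).
Implicit Types u v : nat -> rat.

(* The unused primality proof parametrizes the type of Cauchy sequences, so that
   its ring structure can be inferred. *)
Definition padic_cauchy & prime p : pred (nat -> rat) := fun u =>
  `[< forall e : rat, 0 < e -> exists N, forall m n, (N <= m)%N -> (N <= n)%N ->
      padic_abs p (u m - u n) < e >].

Definition padic_null : pred (nat -> rat) := fun u =>
  `[< forall e : rat, 0 < e -> exists N, forall n, (N <= n)%N ->
      padic_abs p (u n) < e >].

Local Notation cauchy := (padic_cauchy p_prime).

Let cauchy_bounded u : cauchy u ->
  exists2 M, 0 < M & forall n, padic_abs p (u n) <= M.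
Proof.
move=> /asboolP /(_ 1 ltr01)[N cN].
exists (1 + \sum_(i < N.+1) padic_abs p (u i)) => [|n].
  by rewrite ltr_pwDl// sumr_ge0// => i _; rewrite padic_abs_ge0.
have [nN|Nn] := ltnP n N.+1.
  rewrite (bigD1 (Ordinal nN))//= addrCA lerDl addr_ge0// sumr_ge0// => i _.
  by rewrite padic_abs_ge0.
rewrite -(subrK (u N) (u n)) (le_trans (padic_absD _ _ _))//.
rewrite lerD ?(ltW (cN _ _ _ _)) ?(ltnW Nn)//.
rewrite (bigD1 (Ordinal (ltnSn N)))//= lerDl sumr_ge0// => i _.
by rewrite padic_abs_ge0.
Qed.

Fact padic_cauchy_subring : subring_closed cauchy.
Proof.
split=> [|u v /asboolP cu /asboolP cv|u v cu cv].
- apply/asboolP => e e0; exists 0%N => m n _ _.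
  by rewrite [_ - _](_ : _ = 0) ?padic_abs0// subrr.
- apply/asboolP => e e0; have e20 : 0 < e / 2 by lra.
  have [N1 h1] := cu _ e20; have [N2 h2] := cv _ e20.
  exists (maxn N1 N2) => m n; rewrite !geq_max => /andP[m1 m2] /andP[n1 n2].
  rewrite (_ : (u - v) m - (u - v) n = (u m - u n) + - (v m - v n)); last first.
    by rewrite -[LHS]/((u m - v m) - (u n - v n)); ring.
  rewrite (le_lt_trans (padic_absD _ _ _))// padic_absN.
  by have := h1 _ _ m1 n1; have := h2 _ _ m2 n2; lra.
- have [M M0 uM] := cauchy_bounded cu; have [K K0 vK] := cauchy_bounded cv.
  apply/asboolP => e e0.
  have e1 : 0 < e / 2 / K by rewrite !divr_gt0.
  have e2 : 0 < e / 2 / M by rewrite !divr_gt0.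
  move/asboolP : cu => /(_ _ e1)[N1 h1]; move/asboolP : cv => /(_ _ e2)[N2 h2].
  exists (maxn N1 N2) => m n; rewrite !geq_max => /andP[m1 m2] /andP[n1 n2].
  rewrite (_ : (u * v) m - (u * v) n
    = (u m - u n) * v m + u n * (v m - v n)); last first.
    by rewrite -[LHS]/((u m * v m) - (u n * v n)); ring.
  rewrite (le_lt_trans (padic_absD _ _ _))// !padic_absM//.
  rewrite [ltRHS](splitr e) ltrD//.
    rewrite -(divfK (lt0r_neq0 K0) (e / 2)).
    by rewrite (le_lt_trans (ler_wpM2l (padic_abs_ge0 _ _) (vK m)))// ltr_pM2r// h1.
  rewrite -(divfK (lt0r_neq0 M0) (e / 2)) [ltRHS]mulrC.
  by rewrite (le_lt_trans (ler_wpM2r (padic_abs_ge0 _ _) (uM n)))// ltr_pM2l// h2.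
Qed.
HB.instance Definition _ :=
  GRing.isSubringClosed.Build (nat -> rat) cauchy padic_cauchy_subring.

Record cauchy_seq := CauchySeq {
  cauchy_val :> nat -> rat;
  cauchy_valP : cauchy_val \in cauchy }.
HB.instance Definition _ := [isSub for cauchy_val].
HB.instance Definition _ := [Choice of cauchy_seq by <:].
HB.instance Definition _ := [SubChoice_isSubComNzRing of cauchy_seq by <:].

Definition null_seq : pred cauchy_seq := fun w => padic_null w.

Fact null_seq_ideal : idealr_closed null_seq.
Proof.
split=> [||a u v /asboolP nu /asboolP nv].
- by apply/asboolP => e e0; exists 0%N => n _; rewrite padic_abs0.
- apply/negP => /asboolP /(_ 1 ltr01)[N /(_ N (leqnn _))].
  by rewrite padic_abs1// ltxx.
- have [M M0 aM] := cauchy_bounded (cauchy_valP a).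
  apply/asboolP => e e0; have e20 : 0 < e / 2 by lra.
  have e2M : 0 < e / 2 / M by rewrite divr_gt0.
  have [N1 h1] := nu _ e2M; have [N2 h2] := nv _ e20.
  exists (maxn N1 N2) => n; rewrite !geq_max => /andP[n1 n2].
  rewrite (_ : cauchy_val _ n = a n * u n + v n)//.
  rewrite (le_lt_trans (padic_absD _ _ _))// padic_absM//.
  rewrite [ltRHS](splitr e) ltrD ?h2//.
  rewrite -(divfK (lt0r_neq0 M0) (e / 2)) [ltRHS]mulrC.
  by rewrite (le_lt_trans (ler_wpM2r (padic_abs_ge0 _ _) (aM n)))// ltr_pM2l// h1.
Qed.
HB.instance Definition _ := isIdealr.Build cauchy_seq null_seq null_seq_ideal.

End CauchySequences.

Section Padic.
Variables (p : nat) (p_prime : prime p).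
Local Open Scope quotient_scope.
Local Notation cauchy_seq := (cauchy_seq p_prime).
Implicit Types (u v : cauchy_seq).

(* Q_p is the completion of Q: p-adic Cauchy sequences modulo null sequences. *)
Definition padic : Type :=
  {ideal_quot (@null_seq p p_prime : idealr cauchy_seq)}.
HB.instance Definition _ := EqQuotient.on padic.
HB.instance Definition _ := GRing.ComNzRing.on padic.
Implicit Types (x y : padic).

Definition abs_cvg (u : nat -> rat) (c : rat) := forall e : rat, 0 < e ->
  exists N, forall n, (N <= n)%N -> `|padic_abs p (u n) - c| < e.

(* |x|_p is the limit of the absolute values along a Cauchy sequence for x; it
   is rational because these are eventually constant or tend to 0. *)
Definition padic_norm x : rat := xget 0 [set c | abs_cvg (repr x) c].

Let piE0 u : (\pi_padic u == 0) = null_seq u.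
Proof. by rewrite -(rmorph0 \pi_padic) -Quotient.idealrBE subr0. Qed.

Let abs_cvg_uniq (u : nat -> rat) c d : abs_cvg u c -> abs_cvg u d -> c = d.
Proof.
move=> uc ud; apply/eqP; rewrite -subr_eq0 -normr_le0 leNgt; apply/negP => cd.
have cd2 : 0 < `|c - d| / 2 by rewrite divr_gt0.
have [N1 /(_ (maxn N1 _) (leq_maxl N1 _))h1] := uc _ cd2.
have [N2 /(_ (maxn N1 N2) (leq_maxr _ _))h2] := ud _ cd2.
have := h1 N2; have := ler_distD (padic_abs p (u (maxn N1 N2))) c d.
by rewrite [`|c - padic_abs _ _|]distrC; lra.
Qed.

Let null_cvg u : null_seq u -> abs_cvg u 0.
Proof.
move=> /asboolP nu e /nu[N h]; exists N => n /h.
by rewrite subr0 ger0_norm ?padic_abs_ge0.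
Qed.

Let ultra_eq a b : padic_abs p (a - b) < padic_abs p a ->
  padic_abs p a = padic_abs p b.
Proof.
move=> ab; apply/eqP; rewrite eq_le; apply/andP; split.
  have := padic_abs_ultra p_prime (a - b) b; rewrite subrK le_max.
  by rewrite leNgt ab.
have := padic_abs_ultra p_prime (b - a) a; rewrite subrK -opprB padic_absN.
by rewrite le_max => /orP[/le_trans|//]; apply; exact: ltW.
Qed.

Let nonnull_cst u : ~~ null_seq u -> exists N c,
  0 < c /\ forall n, (N <= n)%N -> padic_abs p (u n) = c.
Proof.
move=> /asboolPn/existsNP[e] /not_implyP[e0 /forallNP nu].
have /asboolP/(_ e e0)[N cN] := cauchy_valP u.
have /existsNP[n /not_implyP[Nn /negP une]] := nu N.
rewrite -leNgt in une.
exists N, (padic_abs p (u n)); split; first exact: lt_le_trans une.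
move=> m Nm; apply/esym/ultra_eq; apply: lt_le_trans une; exact: cN.
Qed.

Let abs_cvg_ex u : exists c, abs_cvg u c.
Proof.
have [/null_cvg h|/nonnull_cst[N [c [_ h]]]] := boolP (null_seq u).
  by exists 0.
by exists c => e e0; exists N => n /h ->; rewrite subrr normr0.
Qed.

Let dist_abs a b : `|padic_abs p a - padic_abs p b| <= padic_abs p (a - b).
Proof.
have := padic_absD p_prime (a - b) b; have := padic_absD p_prime (b - a) a.
rewrite !subrK -[b - a]opprB padic_absN ler_norml => ? ?.
by apply/andP; split; lra.
Qed.

Let abs_cvg_eq u v c : u = v %[mod padic] -> abs_cvg u c -> abs_cvg v c.
Proof.
move=> /eqP; rewrite -Quotient.idealrBE => /asboolP uv uc e e0.
have e20 : 0 < e / 2 by lra.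
have [N1 h1] := uv _ e20; have [N2 h2] := uc _ e20.
exists (maxn N1 N2) => n; rewrite geq_max => /andP[/h1 {}h1 /h2 {}h2].
have := le_lt_trans (dist_abs (u n) (v n)) h1.
have := ler_distD (padic_abs p (u n)) (padic_abs p (v n)) c.
by rewrite [`|padic_abs p (v n) - padic_abs p (u n)|]distrC; lra.
Qed.

Lemma padic_norm_pi u c : abs_cvg u c -> padic_norm (\pi_padic u) = c.
Proof.
move=> uc; rewrite /padic_norm; case: xgetP => [d _ ud|/(_ c)/= []].
  by apply: abs_cvg_uniq ud _; apply: abs_cvg_eq uc; rewrite reprK.
by apply: abs_cvg_eq uc; rewrite reprK.
Qed.

Lemma padic_norm0 : padic_norm 0 = 0.
Proof.
rewrite -(rmorph0 \pi_padic); apply/padic_norm_pi/null_cvg.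
by rewrite -piE0 rmorph0.
Qed.

Lemma padic_norm_gt0 x : x != 0 -> 0 < padic_norm x.
Proof.
rewrite -[x]reprK piE0 => /nonnull_cst[N [c [c0 h]]].
rewrite (_ : padic_norm _ = c)//; apply: padic_norm_pi => e e0; exists N => n /h.
by move=> ->; rewrite subrr normr0.
Qed.

Lemma padic_norm_ge0 x : 0 <= padic_norm x.
Proof.
by have [->|/padic_norm_gt0/ltW//] := eqVneq x 0; rewrite padic_norm0.
Qed.

Lemma padic_normN x : padic_norm (- x) = padic_norm x.
Proof.
rewrite -[x]reprK; have [c uc] := abs_cvg_ex (repr x).
rewrite -rmorphN !(padic_norm_pi (c := c))// => e /uc[N h].
by exists N => n /h; rewrite -[X in _ -> `|padic_abs p X - _| < _]/(- repr x n) padic_absN.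
Qed.

Lemma padic_normM x y : padic_norm (x * y) = padic_norm x * padic_norm y.
Proof.
have [->|] := eqVneq x 0; first by rewrite mul0r padic_norm0 mul0r.
have [->|] := eqVneq y 0; first by rewrite mulr0 padic_norm0 mulr0.
rewrite -[x]reprK -[y]reprK !piE0; set u := repr x; set v := repr y.
move=> /nonnull_cst[N1 [c [c0 h1]]] /nonnull_cst[N2 [d [d0 h2]]].
rewrite -rmorphM (padic_norm_pi (u := u) (c := d)).
rewrite (padic_norm_pi (u := v) (c := c)).
rewrite (padic_norm_pi (u := u * v) (c := d * c))//.
- move=> e e0; exists (maxn N1 N2) => n; rewrite geq_max => /andP[/h1 vn /h2 un].
  rewrite -[X in `|padic_abs p X - _| < _]/(u n * v n) padic_absM//.
  by rewrite un vn subrr normr0.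
- by move=> e e0; exists N1 => n /h1 ->; rewrite subrr normr0.
- by move=> e e0; exists N2 => n /h2 ->; rewrite subrr normr0.
Qed.

Lemma padic_norm_ultra x y :
  padic_norm (x + y) <= Num.max (padic_norm x) (padic_norm y).
Proof.
rewrite -[x]reprK -[y]reprK; set u := repr x; set v := repr y.
have [a ua] := abs_cvg_ex u; have [b vb] := abs_cvg_ex v.
have [c uvc] := abs_cvg_ex (u + v).
rewrite -rmorphD (padic_norm_pi ua) (padic_norm_pi vb) (padic_norm_pi uvc).
rewrite leNgt; apply/negP => abc; set d := Num.max a b in abc.
have [ad bd] : a <= d /\ b <= d by rewrite /d !le_max !lexx orbT.
have e0 : 0 < (c - d) / 2 by lra.
have [[N1 h1] [N2 h2] [N3 h3]] := And3 (ua _ e0) (vb _ e0) (uvc _ e0).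
pose n := maxn N1 (maxn N2 N3).
have n1 : (N1 <= n)%N by rewrite leq_maxl.
have n2 : (N2 <= n)%N by rewrite /n !leq_max leqnn orbT.
have n3 : (N3 <= n)%N by rewrite /n !leq_max leqnn !orbT.
have := padic_abs_ultra p_prime (u n) (v n).
move: (h1 _ n1) (h2 _ n2) (h3 _ n3).
rewrite -[X in padic_abs p X - c]/(u n + v n) !ltr_norml le_max.
by move=> /andP[? ?] /andP[? ?] /andP[? ?] /orP[?|?]; lra.
Qed.

Lemma padic_normD x y : padic_norm (x + y) <= padic_norm x + padic_norm y.
Proof.
rewrite (le_trans (padic_norm_ultra x y))// ge_max lerDl lerDr.
by rewrite !padic_norm_ge0.
Qed.

Let inv_ex x : x != 0 -> exists y, y * x = 1.
Proof.
rewrite -[x]reprK piE0; set u := repr x => /nonnull_cst[N [c [c0 h]]].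
pose w n := (u n)^-1.
have wc : w \in padic_cauchy p_prime.
  apply/asboolP => e e0; have ec : 0 < e * c * c by rewrite !mulr_gt0.
  have /asboolP/(_ _ ec)[N1 h1] := cauchy_valP u.
  exists (maxn N N1) => m n; rewrite !geq_max => /andP[m0 m1] /andP[n0 n1].
  have un0 k : (N <= k)%N -> u k != 0.
    by move=> /h uk; apply/eqP => uk0; move: uk c0; rewrite uk0 padic_abs0 => <-; rewrite ltxx.
  have -> : w m - w n = (u n - u m) * (w m * w n).
    rewrite /w; field; by rewrite !un0.
  have wk k : (N <= k)%N -> padic_abs p (w k) = c^-1.
    move=> Nk; apply: (mulIf (lt0r_neq0 c0)).
    by rewrite mulVf ?lt0r_neq0// -[in LHS](h k Nk) -padic_absM// mulVf ?un0// padic_abs1.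
  rewrite !padic_absM// !wk// -invfM ltr_pdivrMr ?mulr_gt0// mulrA.
  exact: h1.
exists (\pi_padic (CauchySeq wc)); apply/eqP; rewrite -rmorphM -subr_eq0.
rewrite -(rmorph1 \pi_padic) -rmorphB piE0; apply/asboolP => e e0.
exists N => n Nn.
rewrite (_ : cauchy_val _ n = w n * u n - 1)// mulVf ?subrr ?padic_abs0//.
by apply/eqP => uk0; move: (h n Nn) c0; rewrite uk0 padic_abs0 => <-; rewrite ltxx.
Qed.

Definition padic_inv x : padic :=
  if x == 0 then 0 else xget 0 [set y | y * x = 1].

Let padic_mulVf x : x != 0 -> padic_inv x * x = 1.
Proof.
move=> x0; rewrite /padic_inv (negPf x0); case: xgetP => [y _ //|h].
by have [y] := inv_ex x0 => /h.
Qed.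

Let padic_invr0 : padic_inv 0 = 0.
Proof. by rewrite /padic_inv eqxx. Qed.

HB.instance Definition _ :=
  GRing.ComNzRing_isField.Build padic padic_mulVf padic_invr0.

Let cst_cauchy (q : rat) : (fun=> q) \in padic_cauchy p_prime.
Proof. by apply/asboolP => e e0; exists 0%N => *; rewrite subrr padic_abs0. Qed.

Let cst (q : rat) : cauchy_seq := CauchySeq (cst_cauchy q).
Let pi_cst (q : rat) : padic := \pi_padic (cst q).

Let pi_cst_zmod : zmod_morphism pi_cst.
Proof. by move=> q r; rewrite /pi_cst -rmorphB; congr \pi_padic; exact: val_inj. Qed.

Let pi_cst_monoid : monoid_morphism pi_cst.
Proof.
split; first by rewrite -(rmorph1 \pi_padic); congr \pi_padic; exact: val_inj.
by move=> q r; rewrite /pi_cst -rmorphM; congr \pi_padic; exact: val_inj.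
Qed.

HB.instance Definition _ :=
  GRing.isZmodMorphism.Build rat padic pi_cst pi_cst_zmod.
HB.instance Definition _ :=
  GRing.isMonoidMorphism.Build rat padic pi_cst pi_cst_monoid.

Lemma padic_norm_rat (q : rat) : padic_norm (ratr q) = padic_abs p q.
Proof.
rewrite -(fmorph_eq_rat pi_cst); apply: padic_norm_pi => e e0.
by exists 0%N => n _; rewrite subrr normr0.
Qed.

Lemma padic_rat_dense x (e : rat) :
  0 < e -> exists q, padic_norm (x - ratr q) < e.
Proof.
move=> e0; have e20 : 0 < e / 2 by lra.
have /asboolP/(_ _ e20)[N uN] := cauchy_valP (repr x).
exists (repr x N); rewrite -(fmorph_eq_rat pi_cst) -[x in x - _]reprK -rmorphB.
have [c uc] := abs_cvg_ex (repr x - cst (repr x N)).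
rewrite (padic_norm_pi uc); have [N1 /(_ (maxn N N1) (leq_maxr _ _)) h1] := uc _ e20.
have := uN _ _ (leq_maxl N N1) (leqnn N).
move: h1; rewrite -[X in padic_abs p X - c]/(repr x (maxn N N1) - repr x N).
by rewrite ltr_norml => /andP[? ?] ?; lra.
Qed.

End Padic.

Section PadicTopology.
Variables (p : nat) (p_prime : prime p).
Local Notation Qp := (padic p_prime).
Implicit Types x y z : Qp.

(* The metric is rational-valued, so that the topology of Q_p does not depend on
   a choice of real numbers. *)
Let mdist x y := padic_norm (x - y).

Let mdistxx x : mdist x x = 0.
Proof. by rewrite /mdist subrr padic_norm0. Qed.

Let mdist_positivity x y : mdist x y = 0 -> x = y.
Proof.
move=> xy0; apply/eqP; rewrite -subr_eq0; apply: contraT => /padic_norm_gt0.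
by rewrite -/(mdist x y) xy0 ltxx.
Qed.

Let mdist_sym x y : mdist x y = mdist y x.
Proof. by rewrite /mdist -opprB padic_normN. Qed.

Let mdist_triangle y x z : mdist x z <= mdist x y + mdist y z.
Proof.
by rewrite /mdist (le_trans _ (padic_normD _ _))// addrA subrK.
Qed.

HB.instance Definition _ :=
  isMetric.Build rat Qp mdistxx mdist_positivity mdist_sym mdist_triangle.
HB.instance Definition _ := isPointed.Build Qp 0.
(* Measurable sets are the Borel sets. *)
HB.instance Definition _ := Measurable.copy Qp (g_sigma_algebraType (@open Qp)).

End PadicTopology.

Section HardyLittlewoodPolya.
Variables (R : realType) (p : nat) (p_prime : prime p).
Local Notation Qp := (padic p_prime).
Local Open Scope complex_scope.
Implicit Types (f b : Qp -> R[i]) (D : set Qp) (x y : Qp).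

Definition padic_normr x : R := ratr (padic_norm x).

Definition padic_ball (gamma : int) : set Qp :=
  [set x | padic_normr x <= p%:R ^ gamma].

(* Translation invariance and the normalization determine a unique Borel
   measure, the balls being cosets of the compact open subgroups p^k Z_p. *)
Definition normalized_haar (mu : {measure set Qp -> \bar R}) :=
  (forall a D, measurable D -> mu [set a + x | x in D] = mu D) /\
  mu [set x | padic_normr x <= 1] = 1%E.

Definition cmeasurable f :=
  measurable_fun setT (fun x => complex.Re (f x)) /\
  measurable_fun setT (fun x => complex.Im (f x)).

Variable mu : {measure set Qp -> \bar R}.

Definition cintegrable D f :=
  mu.-integrable D (fun x => (complex.Re (f x))%:E) /\
  mu.-integrable D (fun x => (complex.Im (f x))%:E).

Definition cintegral D f : R[i] :=
  (\int[mu]_(x in D) complex.Re (f x)) +i* (\int[mu]_(x in D) complex.Im (f x)).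

Definition HLP_integrand f x : Qp -> R[i] :=
  fun y => f y / (Num.max (padic_normr x) (padic_normr y))%:C.

(* Library integrals are total, with junk values off integrability; this says
   that the integral defining T^p f(x) converges absolutely. *)
Definition HLP_defined f x := cintegrable [set y | y != 0] (HLP_integrand f x).

Definition HLP f : Qp -> R[i] :=
  fun x => cintegral [set y | y != 0] (HLP_integrand f x).

Definition HLP_commutator b f : Qp -> R[i] :=
  fun x => b x * HLP f x - HLP (fun y => b y * f y) x.

Definition Lloc (s : R) f :=
  cmeasurable f /\
  forall K, compact K -> (\int[mu]_(x in K) (Normc.normc (f x) `^ s)%:E < +oo)%E.

Definition ball_mean f (gamma : int) : R[i] :=
  ((fine (mu (padic_ball gamma)))^-1)%:C * cintegral (padic_ball gamma) f.

Definition CMO_norm (s : R) f : \bar R :=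
  ereal_sup (range (fun gamma : int =>
    ((((fine (mu (padic_ball gamma)))^-1)%:E *
      \int[mu]_(x in padic_ball gamma)
        (Normc.normc (f x - ball_mean f gamma) `^ s)%:E) `^ s^-1)%E)).

Definition CMO (s : R) f := Lloc s f /\ (CMO_norm s f < +oo)%E.

(* At x = 0 the factor |x|^alpha gets the value of powR, which is immaterial as
   points are null sets. *)
Definition wLnorm (q alpha : R) f : \bar R :=
  ((\int[mu]_x (Normc.normc (f x) `^ q * padic_normr x `^ alpha)%:E)
    `^ q^-1)%E.

Definition wL (q alpha : R) f := cmeasurable f /\ (wLnorm q alpha f < +oo)%E.

Definition wL_bounded (q alpha : R) (A : (Qp -> R[i]) -> Qp -> R[i]) :=
  exists C : R, forall f, wL q alpha f ->
    wL q alpha (A f) /\ (wLnorm q alpha (A f) <= C%:E * wLnorm q alpha f)%E.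

End HardyLittlewoodPolya.

(* Main.v *)
(* For x in the sphere |x| = p^k let u(x) = 1 + |b(x) - b_{B_k}|. The means
   b_{B_k} are Lipschitz in k, so that for every e > 0 and all nonzero x, y
     |b(x) - b(y)| <= C u(x) u(y) max(|x|,|y|)^(2e) (|x||y|)^(-e),
   while the CMO condition bounds the mean of u^r over each sphere for r = q, q'.
   The commutator is thus dominated by the operator with kernel
   u(x) u(y) (|x||y|)^(-e) max(|x|,|y|)^(2e-1), to which the Schur test with
   weight |y|^(sg/q'), sg = (1+alpha)/q, applies: Hoelder's inequality in y, then
   Tonelli's theorem. Both steps reduce to
     int g(y) |y|^(-t) max(|x|,|y|)^(-th) dy <= c |x|^(1-t-th)
   for t < 1 < t + th and g of bounded mean on spheres, a pair of geometric
   series. *)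
From HB Require Import structures.
Require Import Defs.
From mathcomp Require Import all_boot all_order all_algebra.
From mathcomp Require Import ring lra zify.
From mathcomp Require Import all_classical all_reals all_analysis measurable_realfun.
From mathcomp Require Import complex.
Import Order.TTheory GRing.Theory Num.Theory.
Local Open Scope classical_set_scope.
Local Open Scope ring_scope.
Set Implicit Arguments.
Unset Strict Implicit.
Unset Printing Implicit Defensive.

(** * The p-adic norm *)

(** The means of [b] over centred balls may drift by a multiple of |k - l|, a logarithm of |x|/|y|.
    As max(|x|,|y|)^2/(|x||y|) = p^|k-l|, the radial factor in the kernel bound is p^(e|k-l|): an
    exponential that absorbs this drift at the price of shifting the exponents by multiples of e.
    With the weight |y|^(sg/q') both Schur integrals converge, at e = 0, exactly when 0 < sg < 1,
    which is -1 < alpha < q - 1; this window is open, so a small e > 0 still fits. Oscillation over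
    centred balls has no John-Nirenberg inequality, so each power of u that gets integrated must be
    paid for by the hypothesis on [b]: Hoelder raises u(y) to q', the outer norm raises u(x) to q.
    Integrals being total functions, the commutator merges into one integral with kernel b(x) - b(y)
    only after T^p f and T^p(bf) are known to converge absolutely at x; the Schur bounds therefore
    serve first to get finiteness at every nonzero x. *)

Section PadicNorm.
Variables (p : nat) (p_prime : prime p).
Local Notation Qp := (padic p_prime).
Implicit Types (x y : Qp).

Let p0 : p%:R != 0 :> rat.
Proof. by rewrite pnatr_eq0 -lt0n prime_gt0. Qed.

(** The isosceles property of an ultrametric: the norm is locally constant off 0. Rational
    approximation and openness of spheres both rest on it. *)
Lemma padic_norm_eq_lt x y : padic_norm (x - y) < padic_norm x ->
  padic_norm x = padic_norm y.
Proof.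
move=> xy; apply/eqP; rewrite eq_le; apply/andP; split.
  have := padic_norm_ultra (x - y) y; rewrite subrK le_max.
  by rewrite leNgt xy.
have := padic_norm_ultra (y - x) x; rewrite subrK -opprB padic_normN.
by rewrite le_max => /orP[/le_trans|//]; apply; exact: ltW.
Qed.

Lemma padic_norm_eq0 x : (padic_norm x == 0) = (x == 0).
Proof.
have [->|/padic_norm_gt0] := eqVneq x 0; first by rewrite padic_norm0 eqxx.
by move=> /gt_eqF.
Qed.

(** A rational closer to [x] than |x| has the norm of [x], so the nonzero values are those taken on
    Q. *)
Lemma padic_norm_expz x : x != 0 -> exists k : int, padic_norm x = p%:R ^ k.
Proof.
move=> /padic_norm_gt0 x0; have [r xr] := padic_rat_dense x x0.
have := padic_norm_eq_lt xr; rewrite padic_norm_rat => E.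
have r0 : r != 0.
  by apply: contraTN x0 => /eqP r0; rewrite E r0 padic_abs0 ltxx.
by rewrite E /padic_abs (negPf r0); eexists.
Qed.

Lemma padic_abs_int (c : int) : c != 0 ->
  padic_abs p c%:Q = p%:R ^ (- (logn p `|c|)%:Z).
Proof.
move=> c0; have := padic_abs_frac p_prime c0 (oner_neq0 int).
by rewrite divr1 logn1 sub0r.
Qed.

Let padic_abs_p : padic_abs p p%:R = p%:R^-1.
Proof.
rewrite -[p%:R]/(p%:Z%:Q) padic_abs_int ?eqz_nat -?lt0n ?prime_gt0//.
by rewrite absz_nat logn_prime// eqxx.
Qed.

Lemma padic_norm_int (c : int) : padic_norm (c%:~R : Qp) = padic_abs p c%:Q.
Proof. by rewrite -padic_norm_rat ratr_int. Qed.

Lemma padic_norm_nat_le1 n : padic_norm (n%:R : Qp) <= 1.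
Proof.
have [->|n0] := eqVneq n 0%N; first by rewrite padic_norm0.
rewrite -[n%:R]/(n%:Z%:~R) padic_norm_int padic_abs_int//.
by rewrite -exprnN -exprVn exprn_ile1 ?invr_ge0 ?ler0n// invf_le1 ?ltr0n ?ler1n prime_gt0.
Qed.

Lemma padic_norm_nat_lt n : (0 < n < p)%N -> padic_norm (n%:R : Qp) = 1.
Proof.
move=> /andP[n0 np]; rewrite -[n%:R]/(n%:Z%:~R) padic_norm_int.
rewrite padic_abs_int ?eqz_nat -?lt0n// lognE p_prime n0/=.
by rewrite gtnNdvd.
Qed.

Lemma padic_norm_p : padic_norm (p%:R : Qp) = p%:R^-1.
Proof. by rewrite -[p%:R]/(p%:Z%:~R) padic_norm_int. Qed.

Lemma padic_p_neq0 : p%:R != 0 :> Qp.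
Proof. by rewrite -padic_norm_eq0 padic_norm_p invr_eq0. Qed.

Lemma padic_norm1 : padic_norm (1 : Qp) = 1.
Proof. by rewrite -[1]/(1%:Z%:~R) padic_norm_int padic_abs1. Qed.

Lemma padic_normV x : padic_norm x^-1 = (padic_norm x)^-1.
Proof.
have [->|x0] := eqVneq x 0; first by rewrite invr0 padic_norm0 invr0.
apply: (@mulIf _ (padic_norm x)); first by rewrite padic_norm_eq0.
by rewrite -padic_normM !mulVf// ?padic_norm1// padic_norm_eq0.
Qed.

Lemma padic_norm_exprz (k : int) : padic_norm (p%:R ^ k : Qp) = p%:R ^ (- k).
Proof.
have normX (n : nat) : padic_norm (p%:R ^+ n : Qp) = p%:R ^- n.
  elim: n => [|n IH]; first by rewrite !expr0 padic_norm1 invr1.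
  by rewrite !exprS padic_normM IH padic_norm_p invfM.
case: (intP k) => [|n|n]; first by rewrite oppr0 !expr0z padic_norm1.
- by rewrite -exprnP normX -exprnN.
- by rewrite opprK -exprnN -exprnP padic_normV normX invrK.
Qed.

Lemma padic_abs_dvdn_denq (r : rat) : padic_abs p r <= 1 -> ~~ (p %| `|denq r|)%N.
Proof.
have [->|r0] := eqVneq r 0; first by rewrite Euclid_dvd1.
move=> r1; apply/negP => pd.
have n0 : numq r != 0 by rewrite numq_eq0.
have pn : ~~ (p %| `|numq r|)%N.
  apply/negP => pn; have : (p %| gcdn `|numq r| `|denq r|)%N.
    by rewrite dvdn_gcd pn.
  by rewrite (eqP (coprime_num_den r)) Euclid_dvd1.
move: r1; rewrite /padic_abs (negPf r0).
rewrite [X in _ - X%:Z]lognE p_prime absz_gt0 n0/= (negPf pn) subr0 -exprnP.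
have : (0 < logn p `|denq r|)%N.
  by rewrite logn_gt0 mem_primes p_prime absz_gt0 denq_neq0.
by case: (logn _ _) => // k _; rewrite leNgt exprn_egt1// ltr1n prime_gt1.
Qed.

(** The residue field of Z_p is Z/p: approximate [x] by a rational whose denominator is prime to
    [p], then reduce this rational modulo [p]. *)
Lemma padic_residue x : padic_norm x <= 1 ->
  exists2 i, (i < p)%N & padic_norm (x - i%:R) <= p%:R^-1.
Proof.
move=> x1; have pV0 : 0 < p%:R^-1 :> rat by rewrite invr_gt0 ltr0n prime_gt0.
have pV1 : p%:R^-1 <= 1 :> rat by rewrite invf_le1 ?ltr0n ?ler1n prime_gt0.
have [r xr] := padic_rat_dense x pV0.
have r1 : padic_abs p r <= 1.
  rewrite -(padic_norm_rat p_prime) -[ratr r](subrK x).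
  rewrite (le_trans (padic_norm_ultra _ _))// ge_max x1 andbT -opprB.
  by rewrite padic_normN (le_trans (ltW xr)).
have pd := padic_abs_dvdn_denq r1.
(* A Bezout relation inverts [denq r] modulo [p]; [i] is the residue of [numq r] times this
   inverse. *)
have [i ip di] : exists2 i, (i < p)%N & (p %| numq r - i%:Z * denq r)%Z.
  have [u [v uv]] := Bezoutz (denq r) p%:Z.
  have g1 : gcdz (denq r) p%:Z = 1.
    by rewrite /gcdz absz_nat; congr Posz; apply/eqP; rewrite -/(coprime _ _) coprime_sym prime_coprime.
  rewrite {}g1 in uv.
  have pZ0 : p%:Z != 0 by rewrite eqz_nat -lt0n prime_gt0.
  exists `|((numq r * u) %% p%:Z)%Z|%N.
    by rewrite -ltz_nat gez0_abs ?modz_ge0// ltz_pmod// ltz_nat prime_gt0.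
  rewrite gez0_abs ?modz_ge0// /modz.
  set w := (_ %/ _)%Z; apply/dvdzP; exists (numq r * v + w * denq r).
  rewrite -[X in X - _]mulr1 -[X in _ * X - _]uv; ring.
exists i => //.
rewrite -[x](subrK (ratr r)) -addrA (le_trans (padic_norm_ultra _ _))// ge_max.
rewrite (ltW xr)/= /ratr; set a := numq r; set d := denq r.
have absd : padic_abs p d%:Q = 1.
  rewrite padic_abs_int ?denq_neq0//.
  by rewrite lognE p_prime absz_gt0 denq_neq0/= (negPf pd).
have d0 : d%:~R != 0 :> Qp by rewrite -padic_norm_eq0 padic_norm_int absd oner_eq0.
have /dvdzP[c cE] := di.
have -> : a%:~R / d%:~R - i%:R = p%:R * c%:~R / d%:~R :> Qp.
  apply: (mulIf d0); rewrite mulrBl !divfK//.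
  by rewrite [RHS]mulrC -[p%:R]/(p%:Z%:~R) -[i%:R]/(i%:Z%:~R) -!intrM -cE intrB intrM.
have absc : padic_abs p c%:Q <= 1.
  have [->|c0] := eqVneq c 0; first by rewrite padic_abs0.
  by rewrite padic_abs_int// -exprnN -exprVn exprn_ile1 ?(ltW pV0).
rewrite !padic_normM padic_normV !padic_norm_int absd invr1 mulr1 padic_norm_p.
by rewrite ler_piMr ?(ltW pV0).
Qed.

End PadicNorm.

(** * Measurability of radial functions *)
Section PadicMeasurable.
Variables (p : nat) (p_prime : prime p).
Local Notation Qp := (padic p_prime).
Implicit Types (x y : Qp).

Lemma open_padic_ball x (c : rat) : 0 < c -> open [set y : Qp | padic_norm (y - x) <= c].
Proof.
move=> c0; rewrite openE => y /= yc; rewrite /interior.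
apply/nbhs_ballP; exists c => // z zy /=.
rewrite -[z](subrK y) -addrA (le_trans (padic_norm_ultra _ _))// ge_max yc andbT.
by rewrite -opprB padic_normN ltW.
Qed.

Lemma open_padic_sphere (c : rat) : c != 0 -> open [set y : Qp | padic_norm y = c].
Proof.
move=> c0; rewrite openE => y /= yc; rewrite /interior.
apply/nbhs_ballP; exists c => /=.
  by rewrite lt0r c0 -yc padic_norm_ge0.
by move=> z zy /=; rewrite -yc; apply/esym/padic_norm_eq_lt; rewrite yc.
Qed.

Lemma measurable_padic_sphere (c : rat) : measurable [set y : Qp | padic_norm y = c].
Proof.
(* The sphere of radius 0 is {0}, which is not open; its complement is. *)
have [->|c0] := eqVneq c 0; last first.
  by apply: sub_sigma_algebra; exact: open_padic_sphere.
rewrite -[X in measurable X]setCK; apply: measurableC; apply: sub_sigma_algebra.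
rewrite openE => y /= /eqP y0n; have y0 : 0 < padic_norm y.
  by rewrite lt0r padic_norm_ge0 andbT.
rewrite /interior; apply/nbhs_ballP; exists (padic_norm y) => // z yz; apply/eqP.
by rewrite -(padic_norm_eq_lt yz) gt_eqF.
Qed.

(* The p-adic norm is rational-valued, hence takes countably many values. *)
Lemma measurable_padic_radial d (T : measurableType d) (h : rat -> T) :
  measurable_fun setT (h \o @padic_norm p p_prime).
Proof.
move=> _ Y mY; rewrite setTI.
rewrite (_ : _ @^-1` _ =
    \bigcup_c ([set y : Qp | padic_norm y = c] `&` [set y | Y (h c)])); last first.
  by apply/seteqP; split=> [y /= hy|y [c _ [/= <-]]//]; exists (padic_norm y).
apply: bigcupT_measurable_rat => c; have [Yc|Yc] := pselect (Y (h c)).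
  rewrite (_ : [set _ | Y _] = setT) ?setIT; first exact: measurable_padic_sphere.
  by apply/seteqP; split.
by rewrite (_ : [set _ | Y _] = set0) ?setI0//; apply/seteqP; split.
Qed.

End PadicMeasurable.

(** * Haar measure of balls *)
Section PadicNormr.
Variables (R : realType) (p : nat) (p_prime : prime p).
Local Notation Qp := (padic p_prime).
Local Notation N := (@padic_normr R p p_prime).
Local Notation P := (p%:R : R).
Implicit Types (x y : Qp) (k : int).

Lemma padic_base_gt0 : 0 < P.
Proof. by rewrite ltr0n prime_gt0. Qed.

Lemma padic_base_gt1 : 1 < P.
Proof. by rewrite ltr1n prime_gt1. Qed.

Lemma padic_normr_ge0 x : 0 <= N x.
Proof. by rewrite ler0q padic_norm_ge0. Qed.

Lemma padic_normr_eq0 x : (N x == 0) = (x == 0).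
Proof. by rewrite /padic_normr fmorph_eq0 padic_norm_eq0. Qed.

Lemma padic_normr_gt0 x : (0 < N x) = (x != 0).
Proof. by rewrite lt0r padic_normr_ge0 andbT padic_normr_eq0. Qed.

Lemma padic_normr0 : N 0 = 0.
Proof. by apply/eqP; rewrite padic_normr_eq0. Qed.

Lemma ratr_expz k : ratr (p%:R ^ k) = P ^ k.
Proof. rewrite -[p%:R in RHS](ratr_nat R); case: (intP k) => [|n|n]; first by rewrite !expr0z rmorph1.
- by rewrite -!exprnP rmorphXn.
- by rewrite -!exprnN fmorphV rmorphXn. Qed.

Lemma padic_normr_expz x : x != 0 -> exists k, N x = P ^ k.
Proof.
by move=> /padic_norm_expz[k xk]; exists k; rewrite /padic_normr xk ratr_expz.
Qed.

Lemma padic_ballE k :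
  padic_ball R k = [set x : Qp | padic_norm x <= p%:R ^ k].
Proof.
by apply/seteqP; split=> x; rewrite /padic_ball /padic_normr /= -ratr_expz ler_rat.
Qed.

Lemma measurable_padic_radialr d (T : measurableType d) (h : R -> T) :
  measurable_fun setT (h \o N).
Proof. exact: (measurable_padic_radial (h \o ratr)). Qed.

Lemma measurable_padic_normr : measurable_fun setT N.
Proof. exact: (measurable_padic_radialr id). Qed.

Lemma measurable_padic_ball k : measurable (padic_ball R k : set Qp).
Proof.
rewrite padic_ballE (_ : [set _ | _] = [set x : Qp | padic_norm (x - 0) <= p%:R ^ k]).
  by apply: sub_sigma_algebra; apply: open_padic_ball; rewrite exprz_gt0// ltr0n prime_gt0.
by apply/seteqP; split=> x /=; rewrite subr0.
Qed.

Lemma le_padic_ball k l : k <= l -> padic_ball R k `<=` (padic_ball R l : set Qp).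
Proof.
by move=> kl x /= /le_trans; apply; rewrite ler_weXz2l// ltW// padic_base_gt1.
Qed.

Section Haar.
Variable mu : {measure set Qp -> \bar R}.
Hypothesis mu_haar : normalized_haar mu.

(** With |c| = p^(k+1), the larger ball is the disjoint union of the [p] translates of the smaller
    one by [c * i], i < p. Residues of x / c give the covering; the translates are disjoint because
    the difference of two distinct indices has norm 1. *)
Lemma mu_padic_ballS k : (mu (padic_ball R (k + 1)) = P%:E * mu (padic_ball R k))%E.
Proof.
pose c : Qp := p%:R ^ (- (k + 1)).
pose F (i : 'I_p) := [set c * i%:R + x | x in padic_ball R k].
have p0 : 0 < p%:R :> rat by rewrite ltr0n prime_gt0.
have FE i : F i = [set x : Qp | padic_norm (x - c * i%:R) <= p%:R ^ k].
  apply/seteqP; split=> [_ [x xk <-]|x xk].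
    by move: xk; rewrite padic_ballE /= [X in X - _]addrC addrK.
  exists (x - c * i%:R); last by rewrite addrC subrK.
  by rewrite padic_ballE.
have c0 : c != 0 by rewrite expfz_neq0// padic_p_neq0.
have normc : padic_norm c = p%:R ^ (k + 1) by rewrite padic_norm_exprz opprK.
have kS : p%:R ^ (k + 1) * p%:R^-1 = p%:R ^ k :> rat.
  by rewrite exprzDr ?unitfE ?lt0r_neq0// expr1z mulfK// lt0r_neq0.
have cp0 : 0 < padic_norm c by rewrite padic_norm_gt0.
have mF i : measurable (F i).
  rewrite FE; apply: sub_sigma_algebra; apply: open_padic_ball.
  by rewrite exprz_gt0.
have -> : padic_ball R (k + 1) = \big[setU/set0]_(i < p) F i.
  rewrite -bigcup_seq; apply/seteqP; split=> x.
    rewrite padic_ballE /= => xk.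
    have [|i ip zi] := @padic_residue _ p_prime (x / c).
      by rewrite padic_normM padic_normV ler_pdivrMr// mul1r normc.
    exists (Ordinal ip); first by rewrite /= mem_index_enum.
    rewrite FE /= -[X in X - _](divfK c0) mulrC -mulrBr padic_normM normc -kS.
    by rewrite ler_wpM2l// exprz_ge0// ltW.
  move=> [i /= ip]; rewrite FE padic_ballE /= => xi.
  rewrite -[x](subrK (c * i%:R)) (le_trans (padic_norm_ultra _ _))// ge_max.
  rewrite (le_trans xi) ?ler_weXz2l ?lerDl ?ler1n ?prime_gt0//=.
  by rewrite padic_normM normc ler_piMr ?exprz_ge0 ?(ltW p0)// padic_norm_nat_le1.
have tF : trivIset setT F.
  move=> i j _ _ [x [/=]]; rewrite !FE /= => xi xj.
  wlog ij : i j xi xj / (i <= j)%N => [h|].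
    by have /orP[/h|/h] := leq_total i j; [exact|move=> /(_ xj xi)].
  apply/val_inj/eqP; move: ij; rewrite leq_eqVlt => /orP[//|ij].
  have : padic_norm (c * (j - i)%:R) <= p%:R ^ k.
    rewrite natrB 1?ltnW// (_ : _ * _ = (x - c * i%:R) + - (x - c * j%:R)); last first.
      by ring.
    by rewrite (le_trans (padic_norm_ultra _ _))// ge_max padic_normN xi xj.
  rewrite padic_normM padic_norm_nat_lt; last first.
    by rewrite subn_gt0 ij/= (leq_ltn_trans _ (ltn_ord j))// leq_subr.
  by rewrite mulr1 normc ler_eXz2l ?ltr1n ?prime_gt1// gerDl.
rewrite measure_bigsetU_ord// (eq_bigr (fun=> mu (padic_ball R k))); last first.
  by move=> i _; apply mu_haar.1; exact: measurable_padic_ball.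
by rewrite mule_natl sumr_const card_ord.
Qed.

Lemma mu_padic_ball k : mu (padic_ball R k) = (P ^ k)%:E.
Proof.
have mu0 : mu (padic_ball R 0) = 1%E.
  by rewrite /padic_ball expr0z; exact: mu_haar.2.
have P0 : P != 0 by rewrite lt0r_neq0// padic_base_gt0.
elim/int_rect: k => [|n IH|n IH]; first by rewrite mu0 expr0z.
- by rewrite -[n.+1]addn1 PoszD mu_padic_ballS IH -EFinM exprzDr ?unitfE// expr1z mulrC.
- have := mu_padic_ballS (- n.+1%:Z).
  have -> : - n.+1%:Z + 1 = - n%:Z by lia.
  rewrite IH => E.
  have -> : mu (padic_ball R (- n.+1%:Z)) = (P^-1%:E * (P%:E * mu (padic_ball R (- n.+1%:Z))))%E.
    by rewrite muleA -EFinM mulVf// mul1e.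
  by rewrite -E -EFinM -!exprnN exprS invfM.
Qed.

Lemma mu_padic_zero : mu [set (0 : Qp)%R] = 0%E.
Proof.
apply/eqP; rewrite eq_le measure_ge0 andbT; apply/lee_addgt0Pr => e e0.
(* With this [n], 1/e < n + 1 <= p^n, so the ball of measure p^(-n) has measure at most [e]. *)
pose n := Num.truncn e^-1.
have m0 : measurable ([set 0] : set Qp).
  rewrite (_ : [set 0] = [set x : Qp | padic_norm x = 0]).
    exact: measurable_padic_sphere.
  apply/seteqP; split=> [x ->|x /eqP]; first by rewrite /= padic_norm0.
  by rewrite padic_norm_eq0 => /eqP.
have h : (mu [set (0 : Qp)%R] <= mu (padic_ball R (- n%:Z)))%E.
  apply: le_measure; rewrite ?inE//; first exact: measurable_padic_ball.
  by move=> x ->; rewrite /padic_ball /= padic_normr0 exprz_ge0// ltW// padic_base_gt0.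
rewrite add0e (le_trans h)//.
rewrite mu_padic_ball lee_fin -exprnN invf_ple ?posrE ?exprn_gt0 ?padic_base_gt0//.
rewrite (le_trans (ltW (truncnS_gt _)))// -natrX ler_nat.
exact: ltn_expl (prime_gt1 p_prime).
Qed.

Lemma padic_sigma_finite : sigma_finite setT mu.
Proof.
exists (fun n => padic_ball R n%:Z); last first.
  by move=> n; rewrite mu_padic_ball ltry; split=> //; exact: measurable_padic_ball.
apply/seteqP; split=> // x _; have [->|x0] := eqVneq x 0.
  by exists 0%N; rewrite // /padic_ball /= padic_normr0 expr0z.
have [k xk] := padic_normr_expz x0; exists `|k|%N => //.
by rewrite /padic_ball /= xk ler_weXz2l ?(ltW padic_base_gt1)//; lia.
Qed.

End Haar.
End PadicNormr.

(** * Radial kernels *)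
Lemma nneseries_geometric_le (R : realType) (C r s : R) : 0 <= C ->
  0 <= r < 1 -> 0 <= s < 1 ->
  (\sum_(n <oo) (C * (r ^+ n + s ^+ n))%:E <= (C * ((1 - r)^-1 + (1 - s)^-1))%:E)%E.
Proof.
move=> C0 /andP[r0 r1] /andP[s0 s1].
have geo x n : 0 <= x < 1 -> \sum_(0 <= i < n) x ^+ i <= (1 - x)^-1 :> R.
  move=> /andP[x0 x1]; rewrite -[leRHS]mul1r ler_pdivlMr ?subr_gt0//.
  have := subrX1 x n; rewrite -opprB -[X in _ = X * _]opprB mulNr => /oppr_inj.
  rewrite big_mkord mulrC => <-.
  by rewrite gerBl exprn_ge0.
apply: lime_le.
  by apply: is_cvg_nneseries => n _ _; rewrite lee_fin mulr_ge0// addr_ge0// exprn_ge0.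
apply: nearW => n; rewrite sumEFin lee_fin -big_distrr/= ler_wpM2l// big_split/=.
by rewrite lerD// geo// ?r0 ?s0.
Qed.

Section RadialKernel.
Variables (R : realType) (p : nat) (p_prime : prime p).
Local Notation Qp := (padic p_prime).
Local Notation N := (@padic_normr R p p_prime).
Local Notation P := (p%:R : R).
Variable mu : {measure set Qp -> \bar R}.

Definition padic_sphere (k : int) : set Qp := [set y | N y = P ^ k].

Lemma measurable_padic_spherer k : measurable (padic_sphere k).
Proof.
have := @measurable_padic_normr R p p_prime measurableT _ (measurable_set1 (P ^ k)).
by rewrite setTI.
Qed.

(* At y = 0 the integrand vanishes because powR 0 (- t) = 0 for t <> 0. *)
Lemma padic_radial_kernel_le (t th : R) : 0 < t -> t < 1 -> 1 < t + th ->
  exists2 c : R, 0 <= c & forall (g : Qp -> R) (M : R), 0 <= M ->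
    measurable_fun setT g -> (forall y, 0 <= g y) ->
    (forall k, \int[mu]_(y in padic_sphere k) (g y)%:E <= (M * P ^ k)%:E)%E ->
    forall x, x != 0 ->
    (\int[mu]_y (g y * (N y `^ (- t) * Num.max (N x) (N y) `^ (- th)))%:E
      <= (c * M * N x `^ (1 - t - th))%:E)%E.
Proof.
move=> t0 t1 tth.
have P0 : 0 < P := padic_base_gt0 R p_prime.
have P1 : 1 < P := padic_base_gt1 R p_prime.
(* Ratios of the two series: [r] for the spheres inside |x|, where t < 1 gives decay, and [s] for
   those outside, where t + th > 1 does. *)
pose r := P `^ (- (1 - t)); pose s := P `^ (- (t + th - 1)).
have rs a : 0 < a -> 0 <= P `^ (- a) < 1.
  move=> a0; rewrite powR_ge0/= powRN invf_lt1 ?powR_gt0//.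
  by rewrite -[X in X < _](powRr0 P) /powR gt_eqF// ltr_expR mul0r mulr_gt0// ln_gt0.
have r01 : 0 <= r < 1 by apply: rs; rewrite subr_gt0.
have s01 : 0 <= s < 1 by apply: rs; rewrite subr_gt0.
have geo0 z : 0 <= z < 1 -> 0 <= (1 - z)^-1 :> R.
  by move=> /andP[_ z1]; rewrite invr_ge0 subr_ge0 ltW.
exists ((1 - r)^-1 + (1 - s)^-1); first by rewrite addr_ge0// geo0.
move=> g M M0 mg g0 gM x /(@padic_normr_expz R)[k xk].
(* [u n] and [v n] are the values of the radial factor on the spheres n steps inside and n steps
   outside |x| = p^k, where the maximum is |x|, respectively |y|. The sphere |y| = |x| occurs in
   both families at n = 0, which is harmless for an upper bound. *)
pose u n : R := (P ^ (k - n%:Z)) `^ (- t) * (P ^ k) `^ (- th).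
pose v n : R := (P ^ (k + n%:Z)) `^ (- t) * (P ^ (k + n%:Z)) `^ (- th).
pose f n y : \bar R := ((u n)%:E * ((EFin \o g) \_ (padic_sphere (k - n%:Z))) y
   + (v n)%:E * ((EFin \o g) \_ (padic_sphere (k + n%:Z))) y)%E.
have u0 n : 0 <= u n by rewrite mulr_ge0// powR_ge0.
have v0 n : 0 <= v n by rewrite mulr_ge0// powR_ge0.
have mgS l : measurable_fun setT ((EFin \o g) \_ (padic_sphere l)).
  apply/(measurable_restrictT _ (measurable_padic_spherer l)).
  by apply: measurable_funTS; exact/measurable_EFinP.
have gS0 l y : (0 <= ((EFin \o g) \_ (padic_sphere l)) y)%E.
  by rewrite patchE; case: ifP; rewrite //= lee_fin.
have mf n : measurable_fun setT (f n).
  by apply: emeasurable_funD; apply: measurable_funeM.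
have f0 n y : (0 <= f n y)%E by rewrite adde_ge0// mule_ge0// lee_fin.
have PE z : P ^ z = P `^ z%:~R by rewrite powR_intmul// ltW.
have PD a b : P `^ a * P `^ b = P `^ (a + b) by rewrite powRD// (gt_eqF P0) implybT.
have uE n : u n * (M * P ^ (k - n%:Z)) = M * N x `^ (1 - t - th) * r ^+ n.
  rewrite /u /r xk -powR_mulrn ?powR_ge0// !PE -!powRrM mulrCA -mulrA !PD.
  by congr (_ * _ `^ _); rewrite intrB; ring.
have vE n : v n * (M * P ^ (k + n%:Z)) = M * N x `^ (1 - t - th) * s ^+ n.
  rewrite /v /s xk -powR_mulrn ?powR_ge0// !PE -!powRrM mulrCA -mulrA !PD.
  by congr (_ * _ `^ _); rewrite intrD; ring.
apply: (@le_trans _ _ (\int[mu]_y \sum_(n <oo) f n y)%E); last first.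
  rewrite integral_nneseries//.
  have CE : (((1 - r)^-1 + (1 - s)^-1) * M * N x `^ (1 - t - th)) =
     (M * N x `^ (1 - t - th)) * ((1 - r)^-1 + (1 - s)^-1) by ring.
  rewrite CE; apply: le_trans (nneseries_geometric_le _ r01 s01); last first.
    by rewrite mulr_ge0// powR_ge0.
  apply: lee_nneseries => [n _ _|n _]; first exact: integral_ge0.
  rewrite ge0_integralD//; last 4 first.
  - by move=> y _; rewrite mule_ge0// lee_fin.
  - exact: measurable_funeM.
  - by move=> y _; rewrite mule_ge0// lee_fin.
  - exact: measurable_funeM.
  rewrite !ge0_integralZl_EFin// -!integral_mkcond mulrDr -uE -vE !EFinD !(EFinM (u n)) !(EFinM (v n)).
  by rewrite leeD// lee_wpmul2l ?lee_fin.
apply: ge0_le_integral => //.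
- by move=> y _; rewrite lee_fin !mulr_ge0// powR_ge0.
- apply/measurable_EFinP; apply: measurable_funM => //.
  exact: (@measurable_padic_radialr _ _ _ _ _ (fun r => r `^ (- t) * Num.max (N x) r `^ (- th))).
- by apply: ge0_emeasurable_sum.
move=> y _; have [->|] := eqVneq y 0.
  rewrite padic_normr0 powR0 ?mul0r ?mulr0 ?nneseries_ge0//.
  by rewrite oppr_eq0 gt_eqF.
move=> /(@padic_normr_expz R)[j yj].
(* All terms being nonnegative, it suffices to bound the integrand at [y] by the one term that
   belongs to the sphere of [y]. *)
have single n : (f n y <= \sum_(i <oo) f i y)%E.
  have := @nneseries_lim_ge _ (fun i => f i y) xpredT 0%N n.+1.
  move=> /(_ (fun i _ _ => f0 i y)); apply: le_trans.
  by rewrite big_nat_recr//= leeDr// sume_ge0.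
have [jk|kj] := leP j k.
  apply: le_trans (single `|k - j|%N); rewrite /f /u.
  have -> : k - `|k - j|%N%:Z = j by lia.
  rewrite patchE mem_set//= lee_paddr ?mule_ge0 ?lee_fin//.
  rewrite xk yj max_l ?ler_weXz2l ?(ltW P1)// mulrC.
  by [].
apply: le_trans (single `|j - k|%N); rewrite /f /v.
have -> : k + `|j - k|%N%:Z = j by lia.
rewrite [in X in (_ <= _ + X)%E]patchE mem_set//= lee_paddl ?mule_ge0 ?lee_fin//.
by rewrite xk yj max_r ?ler_weXz2l ?(ltW P1) ?(ltW kj)// mulrC.
Qed.

End RadialKernel.

(** * Mean oscillation *)
Section ComplexModulus.
Variable R : realType.
Implicit Types z w : R[i].
Local Notation Re := complex.Re.
Local Notation Im := complex.Im.

Lemma normc_sqrtE z : Normc.normc z = Num.sqrt (Re z ^+ 2 + Im z ^+ 2).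
Proof. by case: z. Qed.

Lemma normc_ge0 z : 0 <= Normc.normc z.
Proof. by rewrite normc_sqrtE sqrtr_ge0. Qed.

Lemma abs_Re_le_normc z : `|Re z| <= Normc.normc z.
Proof. by rewrite normc_sqrtE -sqrtr_sqr ler_wsqrtr// lerDl sqr_ge0. Qed.

Lemma abs_Im_le_normc z : `|Im z| <= Normc.normc z.
Proof. by rewrite normc_sqrtE -sqrtr_sqr ler_wsqrtr// lerDr sqr_ge0. Qed.

Lemma normc_le_abs z : Normc.normc z <= `|Re z| + `|Im z|.
Proof.
rewrite normc_sqrtE -[leRHS]ger0_norm ?addr_ge0// -sqrtr_sqr ler_wsqrtr//.
by rewrite sqrrD !real_normK ?num_real// lerD2r lerDl mulrn_wge0// mulr_ge0.
Qed.

Lemma normc_sub_le (u v w : R[i]) :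
  Normc.normc (u - w) <= Normc.normc (u - v) + Normc.normc (v - w).
Proof. by rewrite -(subrKA v) le_normcD. Qed.

Lemma normc_subC z w : Normc.normc (z - w) = Normc.normc (w - z).
Proof. by rewrite -opprB normcN. Qed.

Lemma measurable_normc d (T : measurableType d) (f : T -> R[i]) :
  measurable_fun setT (fun x => Re (f x)) -> measurable_fun setT (fun x => Im (f x)) ->
  measurable_fun setT (fun x => Normc.normc (f x)).
Proof.
move=> mr mi; rewrite (_ : (fun _ => _) =
    (fun r : R => r `^ 2^-1) \o (fun x => Re (f x) ^+ 2 + Im (f x) ^+ 2)).
  apply: measurableT_comp; first exact: measurable_powR.
  by apply: measurable_funD; exact: measurable_funX.
by apply/funext => x /=; rewrite powR12_sqrt ?addr_ge0 ?sqr_ge0// normc_sqrtE.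
Qed.

End ComplexModulus.

Section MeanOscillation.
Variables (R : realType) (p : nat) (p_prime : prime p).
Local Notation Qp := (padic p_prime).
Local Notation N := (@padic_normr R p p_prime).
Local Notation P := (p%:R : R).
Local Notation B := (@padic_ball R p p_prime).
Variable mu : {measure set Qp -> \bar R}.
Hypothesis mu_haar : normalized_haar mu.
Variable b : Qp -> R[i].
Hypothesis mb : cmeasurable b.

Let P0 : 0 < P := padic_base_gt0 R p_prime.
Let P1 : 1 < P := padic_base_gt1 R p_prime.

Lemma measurable_normc_sub (c : Qp -> R[i]) :
  cmeasurable c ->
  measurable_fun setT (fun y => Normc.normc (b y - c y)).
Proof.
move=> [mcr mci]; apply: measurable_normc.
  rewrite (_ : (fun _ => _) = (fun y => complex.Re (b y) - complex.Re (c y))).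
    by apply: measurable_funB => //; exact: mb.1.
  by apply/funext => y; case: (b y) (c y) => [? ?] [].
rewrite (_ : (fun _ => _) = (fun y => complex.Im (b y) - complex.Im (c y))).
  by apply: measurable_funB => //; exact: mb.2.
by apply/funext => y; case: (b y) (c y) => [? ?] [].
Qed.

Lemma cmeasurable_cst (c : R[i]) : cmeasurable (fun _ : Qp => c).
Proof. by split; exact: measurable_cst. Qed.

(** On a ball, of finite measure, the constant [c] is its own mean, so the left side is the modulus
    of the mean of h - c. Integrability of h - c comes from that of its majorant [g]. *)
Let Rintegral_sub_le (h : Qp -> R) (c : R) (g : Qp -> R) (k : int) (J : R) :
  measurable_fun setT h -> measurable_fun setT g ->
  (forall y, `|h y - c| <= g y) ->
  (\int[mu]_(y in B k) (g y)%:E <= J%:E)%E ->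
  `|(P ^ k)^-1 * (\int[mu]_(y in B k) h y) - c| <= (P ^ k)^-1 * J.
Proof.
move=> mh mg hg gJ.
have mB := @measurable_padic_ball R p p_prime k.
have Pk0 : 0 < P ^ k by rewrite exprz_gt0.
have g0 y : 0 <= g y by apply: le_trans (hg y).
have ig : mu.-integrable (B k) (EFin \o g).
  apply/integrableP; split; first by apply: measurable_funTS; exact/measurable_EFinP.
  rewrite (eq_integral (EFin \o g)); first exact: le_lt_trans gJ (ltry _).
  by move=> y _; rewrite /= ger0_norm.
have ihc : mu.-integrable (B k) (EFin \o (fun y => h y - c)).
  apply: le_integrable ig => //.
    by apply: measurable_funTS; apply/measurable_EFinP; apply: measurable_funB.
  by move=> y _; rewrite /= !lee_fin (le_trans (hg y))// ler_norm.
have ic : mu.-integrable (B k) (EFin \o (fun=> c)).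
  apply: measurable_bounded_integrable => //.
  - by rewrite mu_padic_ball// ltry.
  - by exists `|c|; split; [exact: num_real|move=> r cr y _; exact: ltW].
have hE : \int[mu]_(y in B k) h y = \int[mu]_(y in B k) (h y - c) + c * P ^ k.
  have -> : c * P ^ k = \int[mu]_(y in B k) c.
    by rewrite Rintegral_cst// mu_padic_ball.
  by rewrite -RintegralD//; apply: eq_Rintegral => y _; rewrite subrK.
rewrite hE mulrDr mulrCA mulVf ?gt_eqF// mulr1 addrK normrM gtr0_norm ?invr_gt0//.
rewrite ler_wpM2l ?invr_ge0 ?(ltW Pk0)//.
rewrite (le_trans (le_normr_Rintegral _ _))//.
rewrite -lee_fin; apply: le_trans gJ.
rewrite /Rintegral fineK; last first.
  by apply: integrable_fin_num => //; exact: integrable_norm.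
apply: ge0_le_integral => //.
- by apply/measurable_EFinP; apply: measurableT_comp => //; apply: measurable_funTS; exact: measurable_funB.
- by apply: measurable_funTS; exact/measurable_EFinP.
- by move=> y _; rewrite lee_fin.
Qed.

(** The factor 2 comes from treating real and imaginary parts separately, each dominated by the
    modulus of b - c. In the application [c] is the mean over the next larger ball. *)
Lemma ball_mean_sub_le (k : int) (c : R[i]) (J : R) :
  (\int[mu]_(y in B k) (Normc.normc (b y - c))%:E <= J%:E)%E ->
  Normc.normc (ball_mean mu b k - c) <= 2 * ((P ^ k)^-1 * J).
Proof.
move=> bJ.
have mg := measurable_normc_sub (cmeasurable_cst c).
rewrite (le_trans (normc_le_abs _))// mulr_natl mulr2n /ball_mean mu_padic_ball//=.
apply: lerD.
  rewrite (_ : complex.Re _ = (P ^ k)^-1 * (\int[mu]_(y in B k) complex.Re (b y)) - complex.Re c).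
    apply: (Rintegral_sub_le _ mg) => //; first exact: mb.1.
    move=> y; apply: le_trans (abs_Re_le_normc _).
    by case: (b y) (c) => [? ?] [].
  by case: c {bJ mg} => [? ?] /=; rewrite mul0r subr0.
rewrite (_ : complex.Im _ = (P ^ k)^-1 * (\int[mu]_(y in B k) complex.Im (b y)) - complex.Im c).
  apply: (Rintegral_sub_le _ mg) => //; first exact: mb.2.
  move=> y; apply: le_trans (abs_Im_le_normc _).
  by case: (b y) (c) => [? ?] [].
by case: c {bJ mg} => [? ?] /=; rewrite mul0r addr0.
Qed.

End MeanOscillation.

(** * The oscillation weight and the bound on b(x) - b(y) *)

Section CMOKernel.
Variables (R : realType) (p : nat) (p_prime : prime p).
Local Notation Qp := (padic p_prime).
Local Notation N := (@padic_normr R p p_prime).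
Local Notation P := (p%:R : R).
Local Notation B := (@padic_ball R p p_prime).
Variable mu : {measure set Qp -> \bar R}.
Hypothesis mu_haar : normalized_haar mu.
Variables (s : R) (b : Qp -> R[i]).
Hypotheses (s1 : 1 <= s) (b_CMO : CMO mu s b).

Let P0 : 0 < P := padic_base_gt0 R p_prime.
Let P1 : 1 < P := padic_base_gt1 R p_prime.
Let mb : cmeasurable b := b_CMO.1.1.
Local Notation m := (ball_mean mu b).
Local Notation osc k y := (Normc.normc (b y - m k)).

Let mosc k : measurable_fun setT (fun y => osc k y).
Proof. exact: measurable_normc_sub (cmeasurable_cst _ _). Qed.

Lemma CMO_ball_integral : exists2 M : R, 0 <= M &
  forall k : int, (\int[mu]_(y in B k) (osc k y `^ s)%:E <= (M * P ^ k)%:E)%E.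
Proof.
have s0 : 0 < s by exact: lt_le_trans s1.
have [_ bfin] := b_CMO; set c := CMO_norm mu s b in bfin.
have ck k : ((((fine (mu (B k)))^-1)%:E *
      \int[mu]_(x in B k) (osc k x `^ s)%:E) `^ s^-1 <= c)%E.
  by apply: ereal_sup_ubound; exists k.
have c0 : (0 <= c)%E by apply: le_trans (ck 0); exact: poweR_ge0.
have cE : c = (fine c)%:E by rewrite fineK// ge0_fin_numE.
(* The s-th power of the CMO norm, which undoes the root 1/s in its definition. *)
exists (fine c `^ s) => [|k]; first exact: powR_ge0.
have Pk0 : 0 < P ^ k by rewrite exprz_gt0.
have I0 : (0 <= \int[mu]_(x in B k) (osc k x `^ s)%:E)%E.
  by apply: integral_ge0 => x _; rewrite lee_fin powR_ge0.
have := ck k; rewrite mu_padic_ball//=; set I := integral _ _ _ in I0 *.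
have PI0 : (0 <= ((P ^ k)^-1)%:E * I)%E by rewrite mule_ge0// lee_fin invr_ge0 ltW.
move=> /(@gt0_ler_poweR _ s (ltW s0)).
rewrite !in_itv/= !leey !andbT poweR_ge0 c0 => /(_ isT isT).
rewrite -poweRrM mulVf ?gt_eqF// poweRe1// cE poweR_EFin => h.
rewrite EFinM muleC -lee_pdivrMl//.
Qed.

(** For z >= 0 and r <= s, (1 + z)^r <= (1 + z)^s <= 2^s (1 + z^s). One constant thus serves the
    exponents 1, q and q'. *)
Lemma CMO_ball_moment : exists2 M : R, 0 <= M & forall (r : R) (k : int),
  0 <= r <= s ->
  (\int[mu]_(y in B k) ((1 + osc k y) `^ r)%:E <= (M * P ^ k)%:E)%E.
Proof.
have [M M0 hM] := CMO_ball_integral.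
have s0 : 0 < s by exact: lt_le_trans s1.
exists (2 `^ s * (1 + M)) => [|r k /andP[r0 rs]]; first by rewrite mulr_ge0 ?powR_ge0 ?addr_ge0.
have mB := @measurable_padic_ball R p p_prime k.
have mpow t (g : Qp -> R) : measurable_fun setT g -> measurable_fun (B k) (fun y => (g y `^ t)%:E).
  move=> mg; apply: measurable_funTS; apply/measurable_EFinP.
  exact: (measurableT_comp (measurable_powR t) mg).
have pt z : 0 <= z -> (1 + z) `^ r <= 2 `^ s * (1 + z `^ s) :> R.
  move=> z0; apply: (@le_trans _ _ ((1 + z) `^ s)).
    by rewrite ler_powR// lerDl.
  have [z1|z1] := leP z 1.
    apply: (@le_trans _ _ (2 `^ s)); first by rewrite ge0_ler_powR ?nnegrE ?addr_ge0// ?(ltW s0)//; lra.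
    by rewrite ler_peMr ?powR_ge0// lerDl powR_ge0.
  apply: (@le_trans _ _ ((2 * z) `^ s)).
    by rewrite ge0_ler_powR ?nnegrE ?addr_ge0 ?mulr_ge0// ?(ltW s0)//; lra.
  by rewrite powRM// ler_wpM2l ?powR_ge0// lerDr.
apply: (@le_trans _ _ (\int[mu]_(y in B k) (2 `^ s * (1 + osc k y `^ s))%:E)%E).
  apply: ge0_le_integral => //.
  - by move=> y _; rewrite lee_fin powR_ge0.
  - by apply: mpow; apply: measurable_funD.
  - under eq_fun do rewrite EFinM EFinD.
    by apply: measurable_funeM; apply: emeasurable_funD => //; exact: mpow.
  - by move=> y _; rewrite lee_fin pt// normc_ge0.
under eq_integral do rewrite EFinM EFinD.
rewrite ge0_integralZl_EFin ?powR_ge0//; last 2 first.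
- by move=> y _; rewrite adde_ge0// lee_fin powR_ge0.
- by apply: emeasurable_funD => //; exact: mpow.
rewrite ge0_integralD//; last 2 first.
- by move=> y _; rewrite lee_fin powR_ge0.
- exact: mpow.
rewrite integral_cst// mul1e mu_padic_ball// -mulrA EFinM lee_wpmul2l ?lee_fin ?powR_ge0//.
by rewrite mulrDl mul1r EFinD leeD2l.
Qed.

(** Neighbouring means are compared on the smaller ball: enlarging B_k to B_(k+1) under the integral
    costs only the ratio [p] of their measures. Summing these steps gives the growth in |k - l|. *)
Lemma CMO_ball_mean_lip : exists2 C : R, 0 <= C & forall k l : int,
  Normc.normc (m k - m l) <= C * `|k - l|%:~R.
Proof.
have [M M0 hM] := CMO_ball_moment.
have step k : Normc.normc (m k - m (k + 1)) <= 2 * (M * P).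
  have h : (\int[mu]_(y in B k) (Normc.normc (b y - m (k + 1)))%:E
      <= (M * P ^ (k + 1))%:E)%E.
    apply: le_trans (hM 1 (k + 1) _); last by rewrite ler01.
    apply: (@le_trans _ _ (\int[mu]_(y in B (k + 1)) (osc (k + 1) y)%:E)%E).
      apply: ge0_subset_integral => //; try exact: measurable_padic_ball.
      - by apply: measurable_funTS; exact/measurable_EFinP.
      - by move=> y _; rewrite lee_fin normc_ge0.
      - by apply: le_padic_ball; rewrite lerDl.
    apply: ge0_le_integral => //; first exact: measurable_padic_ball.
    - by move=> y _; rewrite lee_fin normc_ge0.
    - by apply: measurable_funTS; exact/measurable_EFinP.
    - apply: measurable_funTS; apply/measurable_EFinP.
      by apply: (measurableT_comp (measurable_powR _)); apply: measurable_funD.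
    - by move=> y _; rewrite lee_fin powRr1 ?addr_ge0 ?normc_ge0// lerDr.
  apply: le_trans (ball_mean_sub_le mu_haar mb h) _.
  have Pk0 : P ^ k != 0 by rewrite expfz_neq0// gt_eqF.
  by rewrite exprzDr ?unitfE ?gt_eqF// expr1z [M * _]mulrCA mulKf.
exists (2 * (M * P)) => [|k l]; first by rewrite !mulr_ge0// ltW.
wlog kl : k l / k <= l => [h|].
  by have /orP[/h//|/h] := le_total k l; rewrite normc_subC distrC.
have -> : l = k + `|k - l|%N%:Z by lia.
elim: `|k - l|%N => [|n IH]; first by rewrite addr0 subrr Normc.normc0 mulr_ge0// !mulr_ge0// ltW.
apply: le_trans (normc_sub_le _ (m (k + n%:Z)) _) _.
have -> : k + n.+1%:Z = (k + n%:Z) + 1 by lia.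
apply: le_trans (lerD IH (step _)) _.
have -> : `|k - (k + n%:Z)| = n%:Z by lia.
have -> : `|k - (k + n%:Z + 1)| = n%:Z + 1 by lia.
by rewrite intrD mulrDr mulr1.
Qed.

(* The exponent k of r = p^k; junk 0 if r is not a power of p. *)
Let vexp (r : R) : int := xget 0 [set k | r = P ^ k].

Let vexpE k : vexp (P ^ k) = k.
Proof.
rewrite /vexp; case: xgetP => [l _ /= h|/(_ k)]; last by move=> /(_ erefl).
by apply/esym/eqP; rewrite eq_le -!(ler_eXz2l P1) h lexx.
Qed.

(** The summand 1 lets a product of two weights dominate a sum of oscillations, and lets the weight
    be inserted into a bound that lacks it. At y = 0 the index of the ball is the junk value 0. *)
Definition sphere_osc (y : Qp) : R := 1 + osc (vexp (N y)) y.

Lemma sphere_osc_ge1 y : 1 <= sphere_osc y.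
Proof. by rewrite lerDl normc_ge0. Qed.

Lemma measurable_sphere_osc : measurable_fun setT sphere_osc.
Proof.
apply: measurable_funD => //; apply: measurable_normc_sub => //; split.
  exact: (measurable_padic_radialr (fun r => complex.Re (m (vexp r)))).
exact: (measurable_padic_radialr (fun r => complex.Im (m (vexp r)))).
Qed.

Lemma sphere_osc_moment : exists2 M : R, 0 <= M & forall (r : R) (k : int),
  0 <= r <= s ->
  (\int[mu]_(y in @padic_sphere R p p_prime k) (sphere_osc y `^ r)%:E <= (M * P ^ k)%:E)%E.
Proof.
have [M M0 hM] := CMO_ball_moment; exists M; first exact: M0.
move=> r k rs; apply: le_trans (hM r k rs).
rewrite (eq_integral (fun y => ((1 + osc k y) `^ r)%:E)); last first.
  by move=> y /set_mem yk; rewrite /sphere_osc yk vexpE.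
apply: ge0_subset_integral.
- exact: measurable_padic_spherer.
- exact: measurable_padic_ball.
- apply: measurable_funTS; apply/measurable_EFinP.
  by apply: (measurableT_comp (measurable_powR _)); apply: measurable_funD.
- by move=> y _; rewrite lee_fin powR_ge0.
- by move=> y yk; rewrite /padic_ball /= yk.
Qed.

(** For |x| = p^k and |y| = p^l the radial factor is exp(L |k - l|) with L = e ln p. It is at least
    1 + L |k - l|, so a multiple of it dominates the linear drift of the means. That it is at least
    1 serves to bound the kernel of T^p itself. *)
Lemma CMO_kernel_le (e : R) : 0 < e -> exists2 C : R, 1 <= C & forall x y : Qp,
  x != 0 -> y != 0 ->
  Normc.normc (b x - b y) <= C * (sphere_osc x * sphere_osc y *
    (Num.max (N x) (N y) `^ (2 * e) * (N x `^ (- e) * N y `^ (- e)))) /\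
  1 <= Num.max (N x) (N y) `^ (2 * e) * (N x `^ (- e) * N y `^ (- e)).
Proof.
move=> e0; have [C C0 hC] := CMO_ball_mean_lip.
pose L := e * ln P.
have L0 : 0 < L by rewrite mulr_gt0// ln_gt0.
(* Chosen so that (1 + C/L)(1 + L d) >= 1 + C d. *)
exists (1 + C / L) => [|x y]; first by rewrite lerDl divr_ge0// ltW.
move=> /(@padic_normr_expz R)[k xk] /(@padic_normr_expz R)[l yl].
have PE z : P ^ z = P `^ z%:~R by rewrite powR_intmul// ltW.
have PD u v : P `^ u * P `^ v = P `^ (u + v) by rewrite powRD// (gt_eqF P0) implybT.
have maxE : Num.max (P ^ k) (P ^ l) = P ^ Num.max k l.
  have [kl|lk] := leP k l; first by rewrite max_r// ler_eXz2l.
  by rewrite max_l// ler_eXz2l// ltW.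
have -> : Num.max (N x) (N y) `^ (2 * e) * (N x `^ (- e) * N y `^ (- e)) =
    expR (L * `|k - l|%:~R).
  rewrite xk yl maxE !PE -!powRrM !PD /powR (gt_eqF P0) /L; congr expR.
  have -> : `|k - l|%:~R = 2 * (Num.max k l)%:~R - k%:~R - l%:~R :> R.
    by rewrite -[2]/(2%:Z%:~R) -intrM -!intrB; congr _%:~R; lia.
  ring.
set d : R := `|k - l|%:~R; have d0 : 0 <= d by rewrite ler0z.
have Ld0 : 0 <= L * d by rewrite mulr_ge0// ltW.
have Ld : 1 + L * d <= expR (L * d) by exact: expR_ge1Dx.
split; last by apply: le_trans Ld; rewrite lerDl.
(* The path from b(x) to b(y) passes through the means over the balls of radius |x| and |y|. *)
apply: (@le_trans _ _ (osc k x + C * d + osc l y)).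
  apply: le_trans (normc_sub_le _ (m k) _) _; rewrite -addrA lerD2l.
  apply: le_trans (normc_sub_le _ (m l) _) _; rewrite [Normc.normc (m l - _)]normc_subC.
  by rewrite lerD2r hC.
rewrite /sphere_osc xk yl !vexpE mulrCA.
set u := osc k x; set v := osc l y.
have u0 : 0 <= u := normc_ge0 _.
have v0 : 0 <= v := normc_ge0 _.
have CLd : 1 + C * d <= (1 + C / L) * expR (L * d).
  apply: (@le_trans _ _ ((1 + C / L) * (1 + L * d))); last first.
    by rewrite ler_wpM2l// addr_ge0// divr_ge0// ltW.
  have -> : (1 + C / L) * (1 + L * d) = 1 + C * d + (C / L + L * d).
    by field; rewrite gt_eqF.
  by rewrite lerDl addr_ge0// divr_ge0// ltW.
(* A product of factors 1 + u, 1 + v, 1 + w with nonnegative u, v, w contains the sum u + v + w: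
   this is where the sum of oscillations becomes a product of weights. *)
apply: (@le_trans _ _ ((1 + u) * (1 + v) * (1 + C * d))).
  have w0 : 0 <= C * d by rewrite mulr_ge0.
  move: (C * d) w0 => w w0; rewrite -subr_ge0.
  have -> : (1 + u) * (1 + v) * (1 + w) - (u + w + v) =
      1 + u * v + u * w + v * w + u * v * w by ring.
  by rewrite !addr_ge0 ?mulr_ge0.
by rewrite ler_wpM2l// mulr_ge0// addr_ge0.
Qed.

End CMOKernel.

(** * Complex integrals *)
(** Sigma-finiteness, here a hypothesis on a bare measure, is packed into the structure over which
    [fubini_tonelli] is stated; the same measure serves for both variables. *)
Lemma sigma_finite_tonelli d (T : measurableType d) (R : realType)
    (mu : {measure set T -> \bar R}) (f : T * T -> \bar R) :
  sigma_finite setT mu -> measurable_fun setT f -> (forall z, (0 <= f z)%E) ->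
  (\int[mu]_x \int[mu]_y f (x, y) = \int[mu]_y \int[mu]_x f (x, y))%E.
Proof.
move=> sf mf f0; pose H := isSigmaFinite.Build _ _ _ _ sf.
pose H' := isSFinite.Build _ _ _ _ (sfinite_measure_sigma_finite sf).
pose m : {sigma_finite_measure set T -> \bar R} := HB.pack (Measure.sort mu) H H'.
exact: (@fubini_tonelli _ _ _ _ R m m f mf f0).
Qed.

Section ComplexIntegral.
Variables (R : realType) (p : nat) (p_prime : prime p).
Local Notation Qp := (padic p_prime).
Local Notation N := (@padic_normr R p p_prime).
Variable mu : {measure set Qp -> \bar R}.
Local Open Scope complex_scope.
Local Notation Re := complex.Re.
Local Notation Im := complex.Im.
Local Notation D := [set y : Qp | y != 0].
Implicit Types (f g : Qp -> R[i]) (z w : R[i]).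

Lemma ReM z w : Re (z * w) = Re z * Re w - Im z * Im w.
Proof. by case: z w => [? ?] []. Qed.

Lemma ImM z w : Im (z * w) = Re z * Im w + Im z * Re w.
Proof. by case: z w => [? ?] []. Qed.

Lemma ReB z w : Re (z - w) = Re z - Re w.
Proof. by case: z w => [? ?] []. Qed.

Lemma ImB z w : Im (z - w) = Im z - Im w.
Proof. by case: z w => [? ?] []. Qed.

Lemma Re_divc z (r : R) : Re (z / r%:C) = Re z / r.
Proof. by rewrite -fmorphV ReM /= mulr0 subr0. Qed.

Lemma Im_divc z (r : R) : Im (z / r%:C) = Im z / r.
Proof. by rewrite -fmorphV ImM /= mulr0 add0r. Qed.

Lemma normc_divc z (r : R) : 0 <= r -> Normc.normc (z / r%:C) = Normc.normc z / r.
Proof.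
move=> r0; rewrite Normc.normcM -fmorphV; congr (_ * _).
by rewrite normc_sqrtE /= expr0n/= addr0 sqrtr_sqr ger0_norm// invr_ge0.
Qed.

Lemma cmeasurableM f g : cmeasurable f -> cmeasurable g ->
  cmeasurable (fun y => f y * g y).
Proof.
move=> [fr fi] [gr gi]; split.
  under eq_fun do rewrite ReM.
  by apply: measurable_funB; apply: measurable_funM.
under eq_fun do rewrite ImM.
by apply: measurable_funD; apply: measurable_funM.
Qed.

Lemma cmeasurableB f g : cmeasurable f -> cmeasurable g ->
  cmeasurable (fun y => f y - g y).
Proof.
move=> [fr fi] [gr gi]; split.
  by under eq_fun do rewrite ReB; apply: measurable_funB.
by under eq_fun do rewrite ImB; apply: measurable_funB.
Qed.

Lemma measurable_padic_neq0 : measurable D.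
Proof.
have -> : D = N @^-1` (~` [set 0]).
  by apply/seteqP; split=> y /=; rewrite -(padic_normr_eq0 R) => /eqP.
rewrite -[X in measurable X]setTI; apply: measurable_padic_normr => //.
exact: measurableC.
Qed.

Lemma cintegrable_dominated f (G : Qp -> R) : cmeasurable f ->
  measurable_fun setT G -> (forall y, y != 0 -> Normc.normc (f y) <= G y) ->
  (\int[mu]_y `|G y|%:E < +oo)%E -> cintegrable mu D f.
Proof.
move=> [mr mi] mG fG Gfin.
have iG : mu.-integrable D (EFin \o G).
  apply: (@integrableS _ _ _ _ setT) => //; first exact: measurable_padic_neq0.
  by apply/integrableP; split; first exact/measurable_EFinP.
have mD := measurable_padic_neq0.
split; apply: le_integrable iG => //; try by apply: measurable_funTS; exact/measurable_EFinP.
  move=> y /fG h; rewrite /= lee_fin (le_trans (abs_Re_le_normc _))//.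
  by rewrite (le_trans h)// ler_norm.
move=> y /fG h; rewrite /= lee_fin (le_trans (abs_Im_le_normc _))//.
by rewrite (le_trans h)// ler_norm.
Qed.

(** Linearity of the integral rests on the absolute convergence of both terms. With [z] equal to
    b(x) it merges the two halves of the commutator. *)
Lemma cintegral_commutator (z : R[i]) f g : cintegrable mu D f -> cintegrable mu D g ->
  z * cintegral mu D f - cintegral mu D g = cintegral mu D (fun y => z * f y - g y).
Proof.
move=> [fr fi] [gr gi]; have mD := measurable_padic_neq0.
have iZ (r : R) h : mu.-integrable D (EFin \o h) -> mu.-integrable D (EFin \o (fun y => r * h y)).
  by move=> ih; exact: (integrableZl mD r ih).
have iD h k : mu.-integrable D (EFin \o h) -> mu.-integrable D (EFin \o k) ->
    mu.-integrable D (EFin \o (fun y => h y + k y)).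
  by move=> ih ik; exact: (integrableD mD ih ik).
have iB h k : mu.-integrable D (EFin \o h) -> mu.-integrable D (EFin \o k) ->
    mu.-integrable D (EFin \o (fun y => h y - k y)).
  by move=> ih ik; exact: (integrableB mD ih ik).
apply/eqP; rewrite eq_complex ReB ImB ReM ImM /=; apply/andP; split; apply/eqP.
  rewrite -!RintegralZl// -!RintegralB//; try by [apply: iZ|apply: iB; apply: iZ].
  by apply: eq_Rintegral => y _; rewrite ReB ReM.
rewrite -!RintegralZl// -RintegralD//; try exact: iZ.
rewrite -RintegralB//; last by apply: iD; apply: iZ.
by apply: eq_Rintegral => y _; rewrite ImB ImM.
Qed.

(** The crude constant 2, from adding the bounds for real and imaginary parts, only changes the
    final operator bound. *)
Lemma normc_cintegral_le f : cmeasurable f -> cintegrable mu D f ->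
  ((Normc.normc (cintegral mu D f))%:E <= 2%:E * \int[mu]_(y in D) (Normc.normc (f y))%:E)%E.
Proof.
move=> mf [fr fi]; have mD := measurable_padic_neq0.
have mN : measurable_fun D (fun y => (Normc.normc (f y))%:E).
  apply: measurable_funTS; apply/measurable_EFinP; apply: measurable_normc.
    exact: mf.1.
  exact: mf.2.
have part (h : Qp -> R) : measurable_fun setT h -> mu.-integrable D (EFin \o h) ->
    (forall y, `|h y| <= Normc.normc (f y)) ->
    (`|\int[mu]_(y in D) h y|%:E <= \int[mu]_(y in D) (Normc.normc (f y))%:E)%E.
  move=> mh ih hle.
  apply: (@le_trans _ _ (\int[mu]_(y in D) `|h y|)%:E).
    by rewrite lee_fin le_normr_Rintegral.
  rewrite /Rintegral fineK; last first.
    by apply: integrable_fin_num => //; exact: integrable_norm.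
  apply: ge0_le_integral => //.
  - by apply: measurable_funTS; apply/measurable_EFinP; exact: measurableT_comp.
  - by move=> y _; rewrite lee_fin.
rewrite -[2]/(1 + 1) EFinD ge0_muleDl ?lee_fin// mul1e.
apply: (@le_trans _ _ (`|Re (cintegral mu D f)| + `|Im (cintegral mu D f)|)%:E).
  by rewrite lee_fin normc_le_abs.
rewrite EFinD leeD// part//.
- exact: mf.1.
- by move=> y; exact: abs_Re_le_normc.
- exact: mf.2.
- by move=> y; exact: abs_Im_le_normc.
Qed.

End ComplexIntegral.

(** * The weighted Schur test *)
(** Hoelder's inequality raised to the power q, which removes the root from the factor with exponent
    q; the other exponent becomes q/q' = q - 1. *)
Lemma hoelder_powR d (T : measurableType d) (R : realType)
    (mu : {measure set T -> \bar R}) (q q' : R) (f g : T -> R) :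
  1 < q -> q^-1 + q'^-1 = 1 ->
  measurable_fun setT f -> measurable_fun setT g ->
  (forall y, 0 <= f y) -> (forall y, 0 <= g y) ->
  ((\int[mu]_y (f y * g y)%:E) `^ q <=
   (\int[mu]_y (f y `^ q')%:E) `^ (q - 1) * \int[mu]_y (g y `^ q)%:E)%E.
Proof.
move=> q1 qq' mf mg f0 g0.
have q0 : 0 < q by exact: lt_trans q1.
have q'V : q'^-1 = 1 - q^-1 by rewrite -qq' addrAC subrr add0r.
have q'0 : 0 < q' by rewrite -invr_gt0 q'V subr_gt0 invf_lt1.
have If0 : (0 <= \int[mu]_y (f y `^ q')%:E)%E.
  by apply: integral_ge0 => y _; rewrite lee_fin powR_ge0.
have Ig0 : (0 <= \int[mu]_y (g y `^ q)%:E)%E.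
  by apply: integral_ge0 => y _; rewrite lee_fin powR_ge0.
have := hoelder mu mf mg q'0 q0; rewrite addrC => /(_ qq').
have LE (h : T -> R) r : (forall y, 0 <= h y) ->
    ('N[mu]_r%:E[EFin \o h] = (\int[mu]_y (h y `^ r)%:E) `^ r^-1)%E.
  move=> h0; rewrite unlock; congr (_ `^ _)%E; apply: eq_integral => y _.
  by rewrite /= ger0_norm.
have fg0 y : 0 <= f y * g y by rewrite mulr_ge0.
rewrite !LE// invr1 poweRe1; last by apply: integral_ge0 => y _; rewrite lee_fin powR_ge0.
rewrite (_ : (\int[mu]_y ((f \* g) y `^ 1)%:E = \int[mu]_y (f y * g y)%:E)%E); last first.
  by apply: eq_integral => y _; rewrite powRr1 //; exact: fg0.
move=> /(@gt0_ler_poweR _ q (ltW q0)).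
rewrite !in_itv/= !leey !andbT integral_ge0 ?mule_ge0 ?poweR_ge0// => [|y _]; last by rewrite lee_fin.
move=> /(_ isT isT); rewrite poweRM ?poweR_ge0// -!poweRrM mulVf ?gt_eqF// poweRe1//.
congr (_ <= _ `^ _ * _)%E.
by rewrite q'V mulrBl mul1r mulVf// gt_eqF.
Qed.

Section WeightedSchur.
Variables (R : realType) (p : nat) (p_prime : prime p).
Local Notation Qp := (padic p_prime).
Local Notation N := (@padic_normr R p p_prime).
Local Notation P := (p%:R : R).
Variable mu : {measure set Qp -> \bar R}.
Hypothesis mu_haar : normalized_haar mu.
Variables (q q' : R).
Hypotheses (q1 : 1 < q) (qq' : q^-1 + q'^-1 = 1).
Variables (u : Qp -> R) (M : R).
Hypotheses (meas_u : measurable_fun setT u) (u1 : forall y, 1 <= u y) (M0 : 0 <= M).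
Hypothesis uM : forall r k, r = q \/ r = q' ->
  (\int[mu]_(y in @padic_sphere R p p_prime k) (u y `^ r)%:E <= (M * P ^ k)%:E)%E.
Variables (sg e : R).
Hypotheses (sg0 : 0 < sg) (sg1 : sg < 1) (e0 : 0 < e).
Hypotheses (esg : 2 * e < sg) (eq'sg : e * q' < 1 - sg).
Implicit Types F : Qp -> R.

(* The weighted bounds below need 2e < sg and e q' < 1 - sg; the exponent
   sg * (q - 1) is that of the q-th power of the weight |y|^(sg/q'). *)
Definition schur_kernel (x y : Qp) : R := Num.max (N x) (N y) `^ (- (1 - 2 * e)).

(** The factors u(x) and |x|^(-e) of the dominating kernel do not depend on y and are kept
    outside. *)
Definition schur_op F x : \bar R :=
  (\int[mu]_y (u y * F y * (N y `^ (- e) * schur_kernel x y))%:E)%E.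

(** The factor with exponent q in Hoelder's inequality: the weight becomes (|y|^(sg/q'))^q =
    |y|^(sg(q-1)), and the share 1/q of the kernel becomes the whole kernel. *)
Definition schur_majorant F x : \bar R :=
  (\int[mu]_y (F y `^ q * (N y `^ (sg * (q - 1)) * schur_kernel x y))%:E)%E.

Let q0 : 0 < q. Proof. exact: lt_trans q1. Qed.
Let q'V : q'^-1 = 1 - q^-1. Proof. by rewrite -qq' addrAC subrr add0r. Qed.
Let q'0 : 0 < q'. Proof. by rewrite -invr_gt0 q'V subr_gt0 invf_lt1. Qed.
Let qVq' : q / q' = q - 1.
Proof. by rewrite q'V mulrBr mulr1 divff// gt_eqF. Qed.
Let q'1 : q' * (q - 1) = q.
Proof. by rewrite -qVq' mulrCA divff ?mulr1// gt_eqF. Qed.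

Let u0 y : 0 <= u y. Proof. exact: le_trans (u1 y). Qed.

Let max_gt0 x y : x != 0 -> 0 < Num.max (N x) (N y).
Proof. by move=> x0; rewrite lt_max padic_normr_gt0 x0. Qed.

Lemma measurable_schur_kernel x (a : R) :
  measurable_fun setT (fun y => N y `^ a * schur_kernel x y).
Proof.
exact: (@measurable_padic_radialr R p p_prime _ _
  (fun r => r `^ a * Num.max (N x) r `^ (- (1 - 2 * e)))).
Qed.

(** [x] enters only through |x|, which makes the majorant measurable for an arbitrary [F]. *)
Lemma measurable_schur_majorant F : measurable_fun setT (schur_majorant F).
Proof.
exact: (@measurable_padic_radialr R p p_prime _ _ (fun r : R =>
  (\int[mu]_y (F y `^ q * (N y `^ (sg * (q - 1)) *
     Num.max r (N y) `^ (- (1 - 2 * e))))%:E)%E)).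
Qed.

Let mpow (g : Qp -> R) (a : R) : measurable_fun setT g ->
  measurable_fun setT (fun y => g y `^ a).
Proof. by move=> mg; exact: (measurableT_comp (measurable_powR a) mg). Qed.

(** With th = 1 - 2e and s = sg/q', the kernel splits as max^(-th/q') max^(-th/q) and |y|^(-e) as
    |y|^(-(e+s)) |y|^s. The first halves, together with u, are raised to q' and give a radial
    integral of order |x|^(2e-(sg+e q')); the second halves give the majorant. *)
Lemma schur_op_hoelder : exists2 c : R, 0 <= c & forall F x,
  measurable_fun setT F -> (forall y, 0 <= F y) -> x != 0 ->
  (schur_op F x `^ q <=
    (c * N x `^ ((2 * e - (sg + e * q')) * (q - 1)))%:E * schur_majorant F x)%E.
Proof.
(* The radial bound is used with t = sg + e q' and th = 1 - 2e: e q' < 1 - sg gives convergence near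
   0, and 2e < sg gives it at infinity. *)
have t0 : 0 < sg + e * q' by rewrite addr_gt0// mulr_gt0.
have t1 : sg + e * q' < 1 by rewrite -ltrBrDl.
have tth : 1 < sg + e * q' + (1 - 2 * e).
  have eq0 : 0 < e * q' by rewrite mulr_gt0// q'0.
     move: esg eq0; lra.
have [c1 c10 hc1] := padic_radial_kernel_le mu t0 t1 tth.
exists ((c1 * M) `^ (q - 1)) => [|F x mF F0 x0]; first exact: powR_ge0.
pose s := sg / q'; have s0 : 0 < s by rewrite divr_gt0.
pose th := 1 - 2 * e.
pose mx y := Num.max (N x) (N y).
have mx0 y : 0 < mx y := max_gt0 y x0.
pose f y := u y * (N y `^ (- (e + s)) * mx y `^ (- th / q')).
pose g y := F y * (N y `^ s * mx y `^ (- th / q)).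
have f0 y : 0 <= f y by rewrite !mulr_ge0// powR_ge0.
have g0 y : 0 <= g y by rewrite !mulr_ge0// powR_ge0.
have mf : measurable_fun setT f.
  apply: measurable_funM => //.
  exact: (@measurable_padic_radialr R p p_prime _ _
    (fun r => r `^ (- (e + s)) * Num.max (N x) r `^ (- th / q'))).
have mg : measurable_fun setT g.
  apply: measurable_funM => //.
  exact: (@measurable_padic_radialr R p p_prime _ _
    (fun r => r `^ s * Num.max (N x) r `^ (- th / q))).
have opE : schur_op F x = (\int[mu]_y (f y * g y)%:E)%E.
  apply: eq_integral => y _; congr EFin.
  rewrite /f /g /schur_kernel -/(mx y) -/th [RHS]mulrACA; congr (_ * _).
  rewrite [RHS]mulrACA; congr (_ * _).
    (* Exponents do not add at base 0 in general; here both sides vanish because -e and -(e + s) are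
       nonzero. *)
    have [->|y0] := eqVneq y 0.
      have en0 : - e != 0 by rewrite oppr_eq0 gt_eqF.
      have es0 : - (e + s) != 0 by rewrite oppr_eq0 gt_eqF// addr_gt0.
      by rewrite padic_normr0 (powR0 en0) (powR0 es0) mul0r.
    rewrite -powRD; last by rewrite padic_normr_eq0 y0 implybT.
    by congr (_ `^ _); ring.
  rewrite -powRD; last by rewrite (gt_eqF (mx0 y)) implybT.
  by congr (_ `^ _); rewrite -mulrDr [_^-1 + _]addrC qq' mulr1.
have fE y : f y `^ q' = u y `^ q' * (N y `^ (- (sg + e * q')) * mx y `^ (- th)).
  rewrite /f powRM ?u0 ?mulr_ge0 ?powR_ge0// powRM ?powR_ge0// -!powRrM.
  by congr (_ * (_ `^ _ * _ `^ _)); rewrite /s; field; rewrite gt_eqF.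
have gE y : g y `^ q = F y `^ q * (N y `^ (sg * (q - 1)) * mx y `^ (- th)).
  rewrite /g powRM ?F0 ?mulr_ge0 ?powR_ge0// powRM ?powR_ge0// -!powRrM.
  congr (_ * (_ `^ _ * _ `^ _)); last by field; rewrite gt_eqF.
  by rewrite /s -qVq' mulrA mulrAC.
rewrite opE; apply: le_trans (hoelder_powR mu q1 qq' mf mg f0 g0) _.
rewrite [X in (_ * X <= _)%E](_ : _ = schur_majorant F x); last first.
  by apply: eq_integral => y _; rewrite gE.
apply: lee_wpmul2r.
  by apply: integral_ge0 => y _; rewrite lee_fin !mulr_ge0// powR_ge0.
have h : (\int[mu]_y (f y `^ q')%:E <= (c1 * M * N x `^ (2 * e - (sg + e * q')))%:E)%E.
  under eq_integral do rewrite fE.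
  have -> : 2 * e - (sg + e * q') = 1 - (sg + e * q') - (1 - 2 * e) by ring.
  apply: (hc1 (fun y => u y `^ q')) => //; first exact: mpow.
  - by move=> y; exact: powR_ge0.
  - by move=> k; apply: uM; right.
have I0 : (0 <= \int[mu]_y (f y `^ q')%:E)%E.
  by apply: integral_ge0 => y _; rewrite lee_fin powR_ge0.
have cM0 : 0 <= c1 * M by rewrite mulr_ge0.
rewrite powRrM -powRM ?powR_ge0// -poweR_EFin; apply: gt0_ler_poweR => //.
- by rewrite subr_ge0 ltW.
- by rewrite in_itv/= I0 leey.
- by rewrite in_itv/= leey andbT lee_fin mulr_ge0 ?powR_ge0.
Qed.

(** Write |y|^(sg(q-1)) = |y|^(sg q-1) |y|^(1-sg) and bound |y|^(1-sg) by max^(1-sg). The kernel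
    then leaves max^(-(sg-2e)) <= |x|^(-(sg-2e)), as 2e < sg. This gives finiteness at each nonzero
    [x], not merely almost everywhere. *)
Lemma schur_majorant_lty F x : measurable_fun setT F -> (forall y, 0 <= F y) -> x != 0 ->
  (\int[mu]_y (F y `^ q * N y `^ (sg * q - 1))%:E < +oo)%E ->
  (schur_majorant F x < +oo)%E.
Proof.
move=> mF F0 x0 Ffin.
set c := N x `^ (- (sg - 2 * e)).
apply: (@le_lt_trans _ _ (\int[mu]_y (c%:E * (F y `^ q * N y `^ (sg * q - 1))%:E))%E).
  apply: ge0_le_integral => //.
  - by move=> y _; rewrite lee_fin !mulr_ge0// powR_ge0.
  - apply/measurable_EFinP; apply: measurable_funM; first exact: mpow.
    exact: measurable_schur_kernel.
  - apply: measurable_funeM; apply/measurable_EFinP; apply: measurable_funM; first exact: mpow.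
    by apply: mpow; exact: measurable_padic_normr.
  move=> y _; rewrite -EFinM lee_fin [leRHS]mulrCA.
  apply: ler_wpM2l; first exact: powR_ge0.
  have [->|y0] := eqVneq y 0.
    by rewrite padic_normr0 powR0 ?mul0r ?mulr_ge0 ?powR_ge0// mulf_neq0 ?gt_eqF// subr_gt0.
  have Ny0 : 0 < N y by rewrite padic_normr_gt0.
  have mx0 := max_gt0 y x0.
  have -> : sg * (q - 1) = (sg * q - 1) + (1 - sg) by ring.
  rewrite powRD; last by rewrite (gt_eqF Ny0) implybT.
  rewrite [leRHS]mulrC -mulrA /schur_kernel.
  apply: ler_wpM2l; first exact: powR_ge0.
  apply: (@le_trans _ _ (Num.max (N x) (N y) `^ (- (sg - 2 * e)))).
    have -> : - (sg - 2 * e) = (1 - sg) - (1 - 2 * e) by ring.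
    rewrite [leRHS]powRD; last by rewrite (gt_eqF mx0) implybT.
    apply: ler_wpM2r; first exact: powR_ge0.
    apply: ge0_ler_powR; rewrite ?nnegrE ?subr_ge0 ?(ltW sg1) ?(ltW Ny0) ?(ltW mx0)//.
    by rewrite le_max lexx orbT.
  rewrite /c !powRN lef_pV2 ?posrE ?powR_gt0 ?padic_normr_gt0//.
  apply: ge0_ler_powR; rewrite ?nnegrE ?subr_ge0 ?(ltW esg) ?padic_normr_ge0 ?(ltW mx0)//.
  by rewrite le_max lexx.
rewrite ge0_integralZl_EFin ?powR_ge0//; last 2 first.
- by move=> y _; rewrite lee_fin mulr_ge0 ?powR_ge0.
- apply/measurable_EFinP; apply: measurable_funM; first exact: mpow.
  by apply: mpow; exact: measurable_padic_normr.
by rewrite lte_mul_pinfty ?lee_fin ?powR_ge0.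
Qed.

(** After Tonelli the inner integral runs over x, where u^q has bounded means on spheres, and yields
    |y|^(sg-1). Multiplied by |y|^(sg(q-1)) this is |y|^(sg q-1), which is |y|^alpha for sg =
    (1+alpha)/q. *)
Lemma schur_majorant_integral_le : exists2 c : R, 0 <= c & forall F,
  measurable_fun setT F -> (forall y, 0 <= F y) ->
  (\int[mu]_x ((u x `^ q * N x `^ (- (1 - sg + 2 * e)))%:E * schur_majorant F x) <=
   c%:E * \int[mu]_y (F y `^ q * N y `^ (sg * q - 1))%:E)%E.
Proof.
have t0 : 0 < 1 - sg + 2 * e by rewrite addr_gt0 ?subr_gt0 ?mulr_gt0.
have t1 : 1 - sg + 2 * e < 1 by move: esg; lra.
have tth : 1 < 1 - sg + 2 * e + (1 - 2 * e) by move: sg1; lra.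
have [c c0 hc] := padic_radial_kernel_le mu t0 t1 tth.
exists (c * M) => [|F mF F0]; first exact: mulr_ge0.
pose t := 1 - sg + 2 * e.
pose w x := u x `^ q * N x `^ (- t).
pose v y := F y `^ q * N y `^ (sg * (q - 1)).
have mN := @measurable_padic_normr R p p_prime.
have mw : measurable_fun setT w by apply: measurable_funM; exact: mpow.
have mv : measurable_fun setT v by apply: measurable_funM; exact: mpow.
have w0 x : 0 <= w x by rewrite mulr_ge0 ?powR_ge0.
have v0 x : 0 <= v x by rewrite mulr_ge0 ?powR_ge0.
pose G (z : Qp * Qp) := (w z.1 * (v z.2 * schur_kernel z.1 z.2))%:E.
have mk x : measurable_fun setT (schur_kernel x).
  exact: (@measurable_padic_radialr R p p_prime _ _
    (fun r => Num.max (N x) r `^ (- (1 - 2 * e)))).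
have -> : (\int[mu]_x ((u x `^ q * N x `^ (- t))%:E * schur_majorant F x) =
    \int[mu]_x \int[mu]_y G (x, y))%E.
  apply: eq_integral => x _; rewrite -ge0_integralZl_EFin//; last 3 first.
  - by move=> y _; rewrite lee_fin !mulr_ge0// powR_ge0.
  - apply/measurable_EFinP; apply: measurable_funM; first exact: mpow.
    exact: measurable_schur_kernel.
  - exact: w0.
  by apply: eq_integral => y _; rewrite /G /= -EFinM mulrA.
rewrite sigma_finite_tonelli; last 3 first.
- exact: padic_sigma_finite.
- apply/measurable_EFinP; apply: measurable_funM.
    by apply: (measurableT_comp mw); exact: measurable_fst.
  apply: measurable_funM; first by apply: (measurableT_comp mv); exact: measurable_snd.
  apply: (measurableT_comp (measurable_powR _)); apply: measurable_maxr.
    by apply: (measurableT_comp mN); exact: measurable_fst.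
  by apply: (measurableT_comp mN); exact: measurable_snd.
- by move=> z; rewrite lee_fin !mulr_ge0// powR_ge0.
rewrite -ge0_integralZl_EFin//; last 3 first.
- by move=> y _; rewrite lee_fin mulr_ge0 ?powR_ge0.
- by apply/measurable_EFinP; apply: measurable_funM; exact: mpow.
- exact: mulr_ge0.
have kC x y : schur_kernel x y = schur_kernel y x by rewrite /schur_kernel maxC.
have GE y : (\int[mu]_x G (x, y) = (v y)%:E * \int[mu]_x (w x * schur_kernel y x)%:E)%E.
  rewrite -ge0_integralZl_EFin; [|exact: measurableT| | |exact: v0].
  - apply: eq_integral => x _; rewrite (kC y x) -[RHS]EFinM.
    exact: (congr1 EFin (mulrCA (w x) (v y) (schur_kernel x y))).
  - by move=> x _; rewrite lee_fin mulr_ge0 ?w0 ?powR_ge0.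
  - by apply/measurable_EFinP; exact: measurable_funM.
under eq_integral do rewrite GE.
apply: ge0_le_integral => //.
- move=> y _; rewrite mule_ge0// ?lee_fin//; apply: integral_ge0 => x _.
  by rewrite lee_fin mulr_ge0 ?powR_ge0.
- apply: emeasurable_funM; first exact/measurable_EFinP.
  exact: (@measurable_padic_radialr R p p_prime _ _ (fun r : R =>
    (\int[mu]_x (w x * Num.max r (N x) `^ (- (1 - 2 * e)))%:E)%E)).
- apply: measurable_funeM; apply/measurable_EFinP.
  by apply: measurable_funM; exact: mpow.
(* At 0 the factor [v] vanishes, its exponent sg(q-1) being nonzero; the radial bound applies off
   0. *)
move=> y _; have [->|y0] := eqVneq y 0.
  rewrite /v padic_normr0 powR0 ?mulr0 ?mul0e ?mule_ge0 ?lee_fin ?mulr_ge0 ?powR_ge0//.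
  by rewrite mulf_neq0 ?gt_eqF// subr_gt0.
have h : (\int[mu]_x (w x * schur_kernel y x)%:E <=
    (c * M * N y `^ (1 - t - (1 - 2 * e)))%:E)%E.
  rewrite (_ : (\int[mu]_x (w x * schur_kernel y x)%:E)%E =
      (\int[mu]_x (u x `^ q * (N x `^ (- t) * schur_kernel y x))%:E)%E); last first.
    by apply: eq_integral => x _; rewrite /w mulrA.
  apply: (hc (fun x => u x `^ q)) => //; first exact: mpow.
  - by move=> x; exact: powR_ge0.
  - by move=> k; apply: uM; left.
apply: le_trans (lee_wpmul2l _ h) _; first by rewrite lee_fin.
rewrite -!EFinM lee_fin mulrCA; apply: ler_wpM2l; first exact: mulr_ge0.
rewrite /v -mulrA; apply: ler_wpM2l; first exact: powR_ge0.
rewrite -powRD; last by rewrite padic_normr_eq0 y0 implybT.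
by rewrite le_eqVlt; apply/orP; left; apply/eqP; congr (_ `^ _); rewrite /t; ring.
Qed.

End WeightedSchur.

(** * The commutator *)
Lemma ae_padic_neq0 (R : realType) (p : nat) (p_prime : prime p)
    (mu : {measure set (padic p_prime) -> \bar R}) :
  normalized_haar mu -> {ae mu, forall x, x != 0}.
Proof.
move=> mu_haar; exists [set 0]; split; last 2 first.
- exact: mu_padic_zero.
- by move=> x /= /negP; rewrite negbK => /eqP.
rewrite (_ : [set 0] = ~` [set y | y != 0]).
  by apply: measurableC; exact: (measurable_padic_neq0 R).
by apply/seteqP; split=> [x /= ->|x /= /negP/negPn/eqP//]; rewrite eqxx.
Qed.

Section CommutatorBound.
Variables (R : realType) (p : nat) (p_prime : prime p).
Local Notation Qp := (padic p_prime).
Local Notation N := (@padic_normr R p p_prime).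
Local Notation P := (p%:R : R).
Variable mu : {measure set Qp -> \bar R}.
Hypothesis mu_haar : normalized_haar mu.
Variables (q q' alpha : R).
Hypotheses (q1 : 1 < q) (qq' : q^-1 + q'^-1 = 1).
Hypotheses (alpha_gtN1 : -1 < alpha) (alpha_lt : alpha < q - 1).
Variable b : Qp -> R[i].
Hypothesis b_CMO : CMO mu (Num.max q' q) b.

Let q0 : 0 < q. Proof. exact: lt_trans q1. Qed.
Let q'V : q'^-1 = 1 - q^-1. Proof. by rewrite -qq' addrAC subrr add0r. Qed.
Let q'0 : 0 < q'. Proof. by rewrite -invr_gt0 q'V subr_gt0 invf_lt1. Qed.
Let s1 : 1 <= Num.max q' q. Proof. by rewrite le_max (ltW q1) orbT. Qed.
Let mb : cmeasurable b := b_CMO.1.1.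

(** The range of [alpha] is 0 < sg < 1. The choice of [e] leaves a factor 2 to spare in both
    constraints: 2e <= sg/2 and e q' <= (1 - sg)/2. *)
Let sg := (1 + alpha) / q.
Let e := Num.min (sg / 4) ((1 - sg) / (2 * q')).

Let sgq : sg * q = 1 + alpha. Proof. by rewrite /sg divfK// gt_eqF. Qed.
Let sg0 : 0 < sg. Proof. by rewrite divr_gt0//; move: alpha_gtN1; lra. Qed.
Let sg1 : sg < 1. Proof. by rewrite ltr_pdivrMr// mul1r; move: alpha_lt; lra. Qed.
Let e0 : 0 < e.
Proof.
rewrite lt_min divr_gt0 ?sg0 ?ltr0n//= divr_gt0 ?subr_gt0 ?sg1//.
by rewrite mulr_gt0 ?ltr0n// q'0.
Qed.
Let esg : 2 * e < sg.
Proof.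
have : e <= sg / 4 by rewrite ge_min lexx.
by move: sg0; lra.
Qed.
Let eq'sg : e * q' < 1 - sg.
Proof.
have : e <= (1 - sg) / (2 * q') by rewrite ge_min lexx orbT.
rewrite ler_pdivlMr ?mulr_gt0 ?ltr0n ?q'0//.
have : 0 < 1 - sg by rewrite subr_gt0 sg1.
have -> : e * (2 * q') = 2 * (e * q') by ring.
lra.
Qed.

Local Notation u := (sphere_osc mu b).
Let u1 := sphere_osc_ge1 mu b.
Let u0 y : 0 <= u y. Proof. exact: le_trans (u1 y). Qed.
Let meas_u : measurable_fun setT u := measurable_sphere_osc b_CMO.

Local Notation F f := (fun y => Normc.normc (f y)).
Local Notation K := (schur_kernel e).
Local Notation op := (schur_op mu u e).
Local Notation maj := (schur_majorant mu q sg e).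
Local Notation integrand f x := (fun y => u y * Normc.normc (f y) * (N y `^ (- e) * K x y)).
Local Notation D := [set y : Qp | y != 0].
Implicit Types (f : Qp -> R[i]) (x y : Qp).

Let mF f : cmeasurable f -> measurable_fun setT (F f).
Proof. by move=> mf; apply: measurable_normc; [exact: mf.1|exact: mf.2]. Qed.

Let mintegrand f x : cmeasurable f -> measurable_fun setT (integrand f x).
Proof.
move=> mf; apply: measurable_funM; last exact: measurable_schur_kernel.
by apply: measurable_funM; [exact: meas_u|exact: mF].
Qed.

Let integrand_ge0 f x y : 0 <= integrand f x y.
Proof. by rewrite !mulr_ge0 ?u0 ?normc_ge0 ?powR_ge0. Qed.

Let kernel_divE x y : x != 0 ->
  Num.max (N x) (N y) `^ (2 * e) * (N x `^ (- e) * N y `^ (- e)) / Num.max (N x) (N y) =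
  N x `^ (- e) * (N y `^ (- e) * K x y).
Proof.
move=> x0; have mx0 : 0 < Num.max (N x) (N y) by rewrite lt_max padic_normr_gt0 x0.
rewrite -powR_inv1 ?ltW// mulrAC -powRD; last by rewrite (gt_eqF mx0) implybT.
rewrite /schur_kernel (_ : - (1 - 2 * e) = 2 * e - 1); last by ring.
by rewrite mulrC mulrA.
Qed.

Let kernel_ge0 x y : 0 <= N x `^ (- e) * (N y `^ (- e) * K x y).
Proof. by rewrite !mulr_ge0 ?powR_ge0. Qed.

(** The first bound is for the kernel of the commutator, the second for that of T^p, from which
    absolute convergence is drawn. *)
Let kernel_bounds : exists2 C : R, 1 <= C & forall x y : Qp, x != 0 -> y != 0 ->
  Normc.normc (b x - b y) / Num.max (N x) (N y) <=
    C * u x * u y * (N x `^ (- e) * (N y `^ (- e) * K x y)) /\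
  (Num.max (N x) (N y))^-1 <= N x `^ (- e) * (N y `^ (- e) * K x y).
Proof.
have [C C1 hC] := CMO_kernel_le mu_haar s1 b_CMO e0.
exists C => // x y x0 y0; have [h1 h2] := hC x y x0 y0.
have mx0 : 0 < Num.max (N x) (N y) by rewrite lt_max padic_normr_gt0 x0.
have aux (a c v w k m : R) : 0 < m -> a <= c * (v * w * k) -> a / m <= c * v * w * (k / m).
  move=> m0 h; rewrite mulrA; apply: ler_wpM2r; first by rewrite invr_ge0 ltW.
  by apply: le_trans h _; rewrite !mulrA.
have aux1 (k m : R) : 0 < m -> 1 <= k -> m^-1 <= k / m.
  by move=> m0 k1; rewrite ler_peMl// invr_ge0 ltW.
rewrite -kernel_divE//; split; [exact: aux h1|exact: aux1 h2].
Qed.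

Let normc_HLP_integrand f x y : Normc.normc (HLP_integrand f x y) =
  Normc.normc (f y) / Num.max (N x) (N y).
Proof. by rewrite normc_divc// le_max padic_normr_ge0. Qed.

Let cmeasurable_HLP_integrand f x : cmeasurable f -> cmeasurable (HLP_integrand f x).
Proof.
have mr : measurable_fun setT (fun y => (Num.max (N x) (N y))^-1).
  exact: (@measurable_padic_radialr R p p_prime _ _ (fun r => (Num.max (N x) r)^-1)).
move=> [fr fi]; split.
  by under eq_fun do rewrite Re_divc; exact: measurable_funM.
by under eq_fun do rewrite Im_divc; exact: measurable_funM.
Qed.

Let integral_scaled_integrand (c : R) f x : 0 <= c -> cmeasurable f ->
  (\int[mu]_y (c * integrand f x y)%:E = c%:E * op (F f) x)%E.
Proof.
move=> c0 mf; under eq_integral do rewrite EFinM.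
rewrite ge0_integralZl_EFin; [by []|exact: measurableT| | |exact: c0].
  by move=> y _; rewrite lee_fin integrand_ge0.
by apply/measurable_EFinP; exact: mintegrand.
Qed.

Let op_ge0 f x : (0 <= op (F f) x)%E.
Proof. by apply: integral_ge0 => y _; rewrite lee_fin integrand_ge0. Qed.

Let scaled_integrand_lty (c : R) f x : 0 <= c -> cmeasurable f -> (op (F f) x < +oo)%E ->
  (\int[mu]_y `|c * integrand f x y|%:E < +oo)%E.
Proof.
move=> c0 mf opfin; rewrite (eq_integral (fun y => (c * integrand f x y)%:E)).
  by rewrite integral_scaled_integrand// lte_mul_pinfty ?lee_fin.
by move=> y _; rewrite ger0_norm// mulr_ge0// integrand_ge0.
Qed.

(** For T^p f, insert u >= 1 into the second kernel bound. For bf, use |b(y)| <= |b(x)| + |b(x) -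
    b(y)|: at fixed x the first term is a multiple of the previous case, and the other falls under
    the first kernel bound. *)
Let HLP_defined_of_op f x : cmeasurable f -> x != 0 -> (op (F f) x < +oo)%E ->
  HLP_defined mu f x /\ HLP_defined mu (fun y => b y * f y) x.
Proof.
move=> mf x0 opfin; have [C C1 hC] := kernel_bounds.
have C0 : 0 <= C by exact: le_trans C1.
have dom g (c : R) : 0 <= c -> cmeasurable g ->
    (forall y, y != 0 -> Normc.normc (HLP_integrand g x y) <= c * integrand f x y) ->
    HLP_defined mu g x.
  move=> c0 mg hg; apply: (cintegrable_dominated (G := fun y => c * integrand f x y)) => //.
  - exact: cmeasurable_HLP_integrand.
  - by apply: measurable_funM; [exact: measurable_cst|exact: mintegrand].
  - exact: scaled_integrand_lty.
have step (a c : R) y : y != 0 -> 0 <= a -> 0 <= c -> a / Num.max (N x) (N y) <= c * u y * (N x `^ (- e) * (N y `^ (- e) * K x y)) ->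
    a * Normc.normc (f y) / Num.max (N x) (N y) <= c * N x `^ (- e) * integrand f x y.
  move=> y0 a0 c0 h; rewrite mulrAC.
  have aux (v w z k n : R) : c * n * (v * w * (z * k)) = c * v * (n * (z * k)) * w by ring.
  by rewrite aux; apply: ler_wpM2r => //; exact: normc_ge0.
have inv_le y : y != 0 -> (Num.max (N x) (N y))^-1 <= u y * (N x `^ (- e) * (N y `^ (- e) * K x y)).
  move=> y0; have [_ h] := hC x y x0 y0; apply: (le_trans h).
  by apply: ler_peMl; [exact: kernel_ge0|exact: u1].
split.
  apply: (dom _ (N x `^ (- e))); [exact: powR_ge0|exact: mf|].
  move=> y y0; rewrite normc_HLP_integrand.
  by have := step 1 1 y y0 ler01 ler01; rewrite !mul1r; apply; exact: inv_le.
apply: (dom _ ((Normc.normc (b x) + C * u x) * N x `^ (- e))).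
- by rewrite mulr_ge0 ?powR_ge0// addr_ge0 ?normc_ge0// mulr_ge0 ?u0.
- exact: cmeasurableM.
move=> y y0; rewrite normc_HLP_integrand Normc.normcM; apply: step => //.
- exact: normc_ge0.
- by rewrite addr_ge0 ?normc_ge0// mulr_ge0 ?u0.
have [h _] := hC x y x0 y0.
apply: (@le_trans _ _ ((Normc.normc (b x) + Normc.normc (b x - b y)) / Num.max (N x) (N y))).
  apply: ler_wpM2r; first by rewrite invr_ge0 le_max padic_normr_ge0.
  have := normc_sub_le (b y) (b x) 0.
  by rewrite !subr0 normc_subC addrC.
rewrite mulrDl -mulrA [leRHS]mulrDl; apply: lerD; last by rewrite mulrA.
by apply: ler_wpM2l; [exact: normc_ge0|exact: inv_le].
Qed.

Let commutator_le_op : exists2 C : R, 0 <= C & forall f x, cmeasurable f -> x != 0 ->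
  (op (F f) x < +oo)%E ->
  ((Normc.normc (HLP_commutator mu b f x))%:E <=
    (C * (u x * N x `^ (- e)))%:E * op (F f) x)%E.
Proof.
have [C C1 hC] := kernel_bounds; have C0 : 0 <= C by exact: le_trans C1.
exists (2 * C) => [|f x mf x0 opfin]; first by rewrite mulr_ge0.
have [d1 d2] := HLP_defined_of_op mf x0 opfin.
have mbf : cmeasurable (fun y => b y * f y) by exact: cmeasurableM.
have mD : measurable D := measurable_padic_neq0 R (p_prime:=p_prime).
rewrite /HLP_commutator /HLP cintegral_commutator//.
set h := (fun y => _ - _).
have mh : cmeasurable h.
  apply: cmeasurableB; last exact: cmeasurable_HLP_integrand.
  by apply: cmeasurableM; [exact: cmeasurable_cst|exact: cmeasurable_HLP_integrand].
have hE y : h y = (b x - b y) * f y / (Num.max (N x) (N y))%:C%C.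
  by rewrite /h /HLP_integrand mulrA -mulrBl -mulrBl.
have hle y : y != 0 -> Normc.normc (h y) <= C * (u x * N x `^ (- e)) * integrand f x y.
  move=> y0; rewrite hE normc_divc; last by rewrite le_max padic_normr_ge0.
  rewrite Normc.normcM mulrAC; have [hk _] := hC x y x0 y0.
  apply: le_trans (ler_wpM2r (normc_ge0 _) hk) _.
  have aux (v w z k n a : R) : C * v * w * (n * (z * k)) * a = C * (v * n) * (w * a * (z * k)) by ring.
  by rewrite aux.
have c0 : 0 <= C * (u x * N x `^ (- e)) by rewrite !mulr_ge0 ?u0 ?powR_ge0.
apply: (@le_trans _ _ (2%:E * \int[mu]_(y in D) (Normc.normc (h y))%:E)%E).
  apply: normc_cintegral_le => //.
  apply: (cintegrable_dominated (G := fun y => C * (u x * N x `^ (- e)) * integrand f x y)) => //.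
    by apply: measurable_funM; [exact: measurable_cst|exact: mintegrand].
  exact: scaled_integrand_lty.
rewrite -mulrA EFinM -muleA; apply: lee_wpmul2l; first by rewrite lee_fin.
rewrite -integral_scaled_integrand//.
apply: (@le_trans _ _ (\int[mu]_(y in D) (C * (u x * N x `^ (- e)) * integrand f x y)%:E)%E).
  apply: ge0_le_integral => //.
  - by move=> y _; rewrite lee_fin normc_ge0.
  - by apply: measurable_funTS; apply/measurable_EFinP; exact: mF.
  - apply: measurable_funTS; apply/measurable_EFinP.
    by apply: measurable_funM; [exact: measurable_cst|exact: mintegrand].
apply: ge0_subset_integral => //.
- apply/measurable_EFinP.
  by apply: measurable_funM; [exact: measurable_cst|exact: mintegrand].
- by move=> y _; rewrite lee_fin mulr_ge0 ?integrand_ge0.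
Qed.

Let MP : exists2 M : R, 0 <= M & forall r k, r = q \/ r = q' ->
  (\int[mu]_(y in @padic_sphere R p p_prime k) (u y `^ r)%:E <= (M * P ^ k)%:E)%E.
Proof.
have [M M0 hM] := sphere_osc_moment mu_haar s1 b_CMO; exists M; first exact: M0.
move=> r k rqq'; apply: hM; case: rqq' => ->.
  by rewrite (ltW q0) le_max lexx orbT.
by rewrite (ltW q'0) le_max lexx.
Qed.

Let alphaE : sg * q - 1 = alpha. Proof. by rewrite sgq addrAC subrr add0r. Qed.

Let wL_integral_lty f : wL mu q alpha f ->
  (\int[mu]_y (F f y `^ q * N y `^ alpha)%:E < +oo)%E.
Proof. by move=> [_]; apply: lty_poweRy; rewrite invr_eq0 gt_eqF. Qed.

Let maj_lty f x : wL mu q alpha f -> x != 0 -> (maj (F f) x < +oo)%E.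
Proof.
move=> wf x0; apply: (schur_majorant_lty q1 sg0 sg1 esg (mF wf.1) (fun y => normc_ge0 (f y)) x0).
by rewrite alphaE; exact: wL_integral_lty.
Qed.

Let op_lty f x : wL mu q alpha f -> x != 0 -> (op (F f) x < +oo)%E.
Proof.
move=> wf x0; have [M M0 hM] := MP.
have [c c0 hc] := schur_op_hoelder q1 qq' meas_u u1 M0 hM sg0 e0 esg eq'sg.
apply: (@lty_poweRy _ _ q); first by rewrite gt_eqF.
apply: le_lt_trans (hc _ _ (mF wf.1) (fun y => normc_ge0 (f y)) x0) _.
by rewrite lte_mul_pinfty ?maj_lty// lee_fin mulr_ge0 ?powR_ge0.
Qed.

Lemma CMO_HLP_defined f x : wL mu q alpha f -> x != 0 ->
  HLP_defined mu f x /\ HLP_defined mu (fun y => b y * f y) x.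
Proof. by move=> wf x0; apply: HLP_defined_of_op => //; [exact: wf.1|exact: op_lty]. Qed.

(* HLP mu f x depends on x only through |x|. *)
Let cmeasurable_HLP f : cmeasurable (HLP mu f).
Proof.
split.
  exact: (@measurable_padic_radialr R p p_prime _ _ (fun r : R =>
    complex.Re (cintegral mu D (fun y => f y / (Num.max r (N y))%:C%C)))).
exact: (@measurable_padic_radialr R p p_prime _ _ (fun r : R =>
  complex.Im (cintegral mu D (fun y => f y / (Num.max r (N y))%:C%C)))).
Qed.

Lemma cmeasurable_HLP_commutator f : cmeasurable (HLP_commutator mu b f).
Proof.
apply: cmeasurableB; last exact: cmeasurable_HLP.
by apply: cmeasurableM; [exact: mb|exact: cmeasurable_HLP].
Qed.

(** The pointwise bound is raised to the power q and combined with the Hoelder step. The factor in x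
    that results is the one integrated in [schur_majorant_integral_le]. *)
Let commutator_le_maj : exists2 C : R, 0 <= C & forall f x, wL mu q alpha f -> x != 0 ->
  ((Normc.normc (HLP_commutator mu b f x) `^ q * N x `^ alpha)%:E <=
    C%:E * ((u x `^ q * N x `^ (- (1 - sg + 2 * e)))%:E * maj (F f) x))%E.
Proof.
have [M M0 hM] := MP.
have [c c0 hc] := schur_op_hoelder q1 qq' meas_u u1 M0 hM sg0 e0 esg eq'sg.
have [C C0 hC] := commutator_le_op.
exists (C `^ q * c) => [|f x wf x0]; first by rewrite mulr_ge0 ?powR_ge0.
have := hC f x wf.1 x0 (op_lty wf x0).
have uN0 : 0 <= u x * N x `^ (- e) by rewrite mulr_ge0 ?u0 ?powR_ge0.
have CuN0 : 0 <= C * (u x * N x `^ (- e)) by rewrite mulr_ge0.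
move=> /(@gt0_ler_poweR _ q (ltW q0)).
rewrite !in_itv/= !leey !andbT lee_fin normc_ge0 mule_ge0 ?lee_fin ?op_ge0// => /(_ isT isT).
rewrite poweRM ?lee_fin ?op_ge0// !poweR_EFin => h.
rewrite EFinM; apply: le_trans (lee_wpmul2r _ h) _; first by rewrite lee_fin powR_ge0.
have hc' := hc _ _ (mF wf.1) (fun y => normc_ge0 (f y)) x0.
have A0 : (0 <= ((C * (u x * N x `^ (- e))) `^ q)%:E)%E by rewrite lee_fin powR_ge0.
have B0 : (0 <= (N x `^ alpha)%:E)%E by rewrite lee_fin powR_ge0.
apply: le_trans (lee_wpmul2r B0 (lee_wpmul2l A0 hc')) _.
rewrite muleAC !muleA -!EFinM.
rewrite le_eqVlt; apply/orP; left; apply/eqP; congr (_%:E * _)%E.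
rewrite (powRM _ C0 uN0) (powRM _ (u0 x) (powR_ge0 _ _)).
have Nx0 : 0 < N x by rewrite padic_normr_gt0.
have PD a a' : N x `^ a * N x `^ a' = N x `^ (a + a').
  by rewrite powRD// (gt_eqF Nx0) implybT.
(* On the right the three exponents come from (|x|^(-e))^q, the weight and the Hoelder step. The
   identity q'(q - 1) = q cancels the terms in e q, and sg q = 1 + alpha removes [alpha]. *)
have -> : - (1 - sg + 2 * e) = - e * q + alpha + (2 * e - (sg + e * q')) * (q - 1).
  have q'1 : q' * (q - 1) = q.
    have -> : q - 1 = q * q'^-1 by rewrite q'V mulrBr mulr1 divff// gt_eqF.
    by rewrite mulrCA divff ?mulr1// gt_eqF.
  have -> : - e * q + alpha + (2 * e - (sg + e * q')) * (q - 1) =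
     - e * q + (alpha - sg * q) + 2 * e * q - 2 * e + sg - e * (q' * (q - 1)) by ring.
  by rewrite q'1 sgq; ring.
have aux (v w k n a : R) : v * (w * n) * a * (c * k) = v * c * (w * (n * a * k)) by ring.
by rewrite aux -powRrM !PD.
Qed.

Lemma HLP_commutator_bounded : wL_bounded mu q alpha (HLP_commutator mu b).
Proof.
have [M M0 hM] := MP.
have [c c0 hc] := schur_majorant_integral_le mu_haar q1 meas_u M0 hM sg0 sg1 e0 esg.
have [C C0 hC] := commutator_le_maj.
have qV0 : 0 <= q^-1 by rewrite invr_ge0 ltW.
(* [C] comes from the pointwise bound and [c] from the integrated one; the root passes from
   integrals to norms. *)
exists ((C * c) `^ q^-1) => f wf; have mT := cmeasurable_HLP_commutator f.
set I := (\int[mu]_y (F f y `^ q * N y `^ alpha)%:E)%E.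
set J := (\int[mu]_x (F (HLP_commutator mu b f) x `^ q * N x `^ alpha)%:E)%E.
have mwt g : cmeasurable g -> measurable_fun setT (fun y => F g y `^ q * N y `^ alpha).
  move=> mg; apply: measurable_funM.
    exact: (measurableT_comp (measurable_powR q) (mF mg)).
  exact: (measurableT_comp (measurable_powR alpha) (@measurable_padic_normr R p p_prime)).
have mmaj : measurable_fun setT (fun x => ((u x `^ q * N x `^ (- (1 - sg + 2 * e)))%:E * maj (F f) x)%E).
  apply: emeasurable_funM; last exact: measurable_schur_majorant.
  apply/measurable_EFinP; apply: measurable_funM.
    exact: (measurableT_comp (measurable_powR q) meas_u).
  exact: (measurableT_comp (measurable_powR _) (@measurable_padic_normr R p p_prime)).
have maj0 x : (0 <= (u x `^ q * N x `^ (- (1 - sg + 2 * e)))%:E * maj (F f) x)%E.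
  rewrite mule_ge0 ?lee_fin ?mulr_ge0 ?powR_ge0//.
  by apply: integral_ge0 => y _; rewrite lee_fin !mulr_ge0 ?powR_ge0.
have JI : (J <= (C * c)%:E * I)%E.
  apply: (@le_trans _ _ (\int[mu]_x (C%:E * ((u x `^ q * N x `^ (- (1 - sg + 2 * e)))%:E * maj (F f) x)))%E).
    (* The pointwise bound excludes x = 0, a null set, hence a comparison almost everywhere. *)
    apply: ae_ge0_le_integral => //.
    - by move=> x _; rewrite lee_fin mulr_ge0 ?powR_ge0.
    - by apply/measurable_EFinP; exact: mwt.
    - by move=> x _; rewrite mule_ge0 ?lee_fin.
    - exact: measurable_funeM.
    by apply: filterS (ae_padic_neq0 mu_haar) => x x0 _; exact: hC.
  rewrite ge0_integralZl_EFin// EFinM -muleA; apply: lee_wpmul2l; first by rewrite lee_fin.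
  have := hc _ (mF wf.1) (fun y => normc_ge0 (f y)).
  by rewrite alphaE.
have I0 : (0 <= I)%E by apply: integral_ge0 => y _; rewrite lee_fin mulr_ge0 ?powR_ge0.
have J0 : (0 <= J)%E by apply: integral_ge0 => y _; rewrite lee_fin mulr_ge0 ?powR_ge0.
have Cc0 : 0 <= C * c by rewrite mulr_ge0.
have le : (wLnorm mu q alpha (HLP_commutator mu b f) <=
    ((C * c) `^ q^-1)%:E * wLnorm mu q alpha f)%E.
  rewrite /wLnorm -/I -/J -poweR_EFin -poweRM ?lee_fin//.
  apply: gt0_ler_poweR; [exact: qV0| | |exact: JI].
    by rewrite in_itv/= J0 leey.
  by rewrite in_itv/= leey andbT mule_ge0 ?lee_fin.
split; last exact: le.
split; first exact: mT.
apply: le_lt_trans le _; rewrite lte_mul_pinfty ?lee_fin ?powR_ge0//; exact: wf.2.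
Qed.

End CommutatorBound.

(** The first conclusion guarantees that the second concerns the genuine commutator: for almost
    every x the integrals defining T^p f(x) and T^p(bf)(x) converge absolutely, so no junk value of
    a total integral enters the norms. *)
Theorem corollary3p3 (R : realType) (p : nat) (p_prime : prime p)
    (mu : {measure set (padic p_prime) -> \bar R}) (mu_haar : normalized_haar mu)
    (q q' alpha : R) (q_gt1 : 1 < q) (qq' : q^-1 + q'^-1 = 1)
    (alpha_gtN1 : -1 < alpha) (alpha_lt : alpha < q - 1)
    (b : padic p_prime -> R[i]) (b_CMO : CMO mu (Num.max q' q) b) :
  (forall f : padic p_prime -> R[i], wL mu q alpha f ->
     {ae mu, forall x, HLP_defined mu f x /\
                       HLP_defined mu (fun y => b y * f y) x}) /\
  wL_bounded mu q alpha (HLP_commutator mu b).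
Proof.
split; last exact: HLP_commutator_bounded b_CMO.
move=> f wf; apply: filterS (ae_padic_neq0 mu_haar) => x x0.
exact: (CMO_HLP_defined mu_haar q_gt1 qq' alpha_gtN1 alpha_lt b_CMO wf x0).
Qed.
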